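(* Let $(G,\mathcal{G})$ be a measurable space, let $\mu$ be a probability measure on $(G,\mathcal{G})$ and let $\mathcal{Q}$ be a defective adapted cocycle with a finite second moment and satisfying the second-moment deviation inequality with respect to $\mu$. Let $(\mu_t,\ t\in[0,1])$ be a curve of probability measures on $(G,\mathcal{G})$ such that $\mu_0=\mu$ and $\mu_t$ is absolutely continuous with respect to $\mu$ for all $t\in[0,1]$. Assume further that: (i) the Radon–Nikodym derivatives $f_t=d\mu_t/d\mu$ can be chosen such that, for all $a\in G$, the function $t\mapsto\log f_t(a)$ has a derivative at $t=0$, denoted $\nu(a)$, the function $\nu$ is bounded on $G$, and $\sup_{t\in(0,1]}\sup_{a\in G}\big|\frac1t\log f_t(a)-\nu(a)\big|<\infty$; (ii) $\mathcal{Q}$ satisfies the uniform first-moment deviation inequality on the family $(\mu_t,\ t\in[0,1])$. Then the limit of $\frac1t\big(\ell(\mu_t;\mathcal{Q})-\ell(\mu;\mathcal{Q})\big)$ as $t\to0$ exists, and it coincides with $$\sigma(\nu,\mu;\mathcal{Q}):=\lim_{n\to\infty}\frac1n\,\mathbb{E}^\mu\Big[Q_n\sum_{j=1}^n\nu(X_j)\Big]$$ (in particular the latter limit exists).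
   Context: $\Omega=G^{\mathbb{N}^*}$, $\mathbb{N}^*=\{1,2,\dots\}$, with product $\sigma$-field; for a probability measure $\mu$ on $G$, $\mathbb{P}^\mu=\mu^{\otimes\mathbb{N}^*}$ with expectation $\mathbb{E}^\mu$. $X_n:\Omega\to G$ are the coordinate maps, $\mathcal{F}_n=\sigma(X_1,\dots,X_n)$, $\theta_n(\omega_1,\omega_2,\dots)=(\omega_{n+1},\omega_{n+2},\dots)$. A defective adapted cocycle is a sequence $\mathcal{Q}=(Q_n)_{n\in\mathbb{N}^*}$ of real-valued maps on $\Omega$ with $Q_n$ measurable with respect to $\mathcal{F}_n$; $Q_0=0$. Its defect is $\Psi_{n,m}(\omega)=Q_{n+m}(\omega)-Q_n(\omega)-Q_m(\theta_n\omega)$. Finite second moment with respect to $\mu$: $\mathbb{E}^\mu[|Q_1|^2]<\infty$. Second-moment deviation inequality with respect to $\mu$: $\sup_{n,m\in\mathbb{N}}\mathbb{E}^\mu[|\Psi_{n,m}|^2]<\infty$. Uniform first-moment deviation inequality on $(\mu_t)$: $\sup_{t\in[0,1]}\sup_{n,m\in\mathbb{N}}\mathbb{E}^{\mu_t}[|\Psi_{n,m}|]<\infty$. The rate of escape is $\ell(\mu_t;\mathcal{Q}):=\lim_n\frac1n\mathbb{E}^{\mu_t}[Q_n]$; this limit exists whenever $\mathbb{E}^{\mu_t}[|Q_1|]<\infty$ and $\sup_{n,m\in\mathbb{N}}\mathbb{E}^{\mu_t}[|\Psi_{n,m}|]<\infty$. Both conditions hold here for all $t\in[0,1]$: the first because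 $\mathbb{E}^\mu[|Q_1|^2]<\infty$ and the densities $f_t=d\mu_t/d\mu$ are bounded uniformly in $t\in[0,1]$ (as $\nu$ and $\frac1t\log f_t-\nu$ are bounded, uniformly in $t\in(0,1]$), the second by the uniform first-moment deviation inequality on $(\mu_t,\ t\in[0,1])$. *)

(* Defs.v *)
From HB Require Import structures.
From mathcomp Require Import all_boot all_order all_algebra.
From mathcomp Require Import all_classical all_reals all_analysis.
From mathcomp Require Import measurable_realfun.

Set Implicit Arguments.
Unset Strict Implicit.
Unset Printing Implicit Defensive.

Import Order.TTheory GRing.Theory Num.Theory.
Import numFieldNormedType.Exports.

Local Open Scope classical_set_scope.
Local Open Scope ring_scope.

Section path_space.
Context d (G : measurableType d).

(* A sequence (omega_1, omega_2, ...) is coded by w : nat -> G with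
   w i = omega_(i+1). *)
Definition X (n : nat) (w : nat -> G) : G := w n.-1.

Definition shift (n : nat) (w : nat -> G) : nat -> G := fun i => w (n + i)%N.

Definition cylinders (J : set nat) : set (set (nat -> G)) :=
  \bigcup_(j in J) preimage_set_system setT (X j) measurable.

Definition Omega : Type :=
  g_sigma_algebraType (cylinders [set j | (0 < j)%N]).
HB.instance Definition _ := Measurable.on Omega.

(* Generators of F_n = sigma(X_1, ..., X_n). *)
Definition past (n : nat) : set (set (nat -> G)) :=
  cylinders [set j | (0 < j <= n)%N].

Lemma measurable_OmegaE :
  @measurable _ Omega = <<s cylinders [set j | (0 < j)%N] >>.
Proof. by []. Qed.

End path_space.
Arguments past {d} G n.

Section upd.
Context d (G : measurableType d).
Local Notation O := (Omega G).

Definition upd (w : nat -> G) (k : nat) (x : G) : nat -> G :=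
  fun i => if i == k then x else w i.

Lemma measurable_coord i : measurable_fun setT ((fun w => w i) : O -> G).
Proof.
move=> _ A mA; rewrite setTI; apply: sub_sigma_algebra.
by exists i.+1 => //; exists A => //; rewrite setTI.
Qed.

Lemma measurable_toO d' (T : measurableType d') (f : T -> O) :
  (forall i, measurable_fun setT (fun t => f t i)) -> measurable_fun setT f.
Proof.
move=> mf; apply: (measurability _ (measurable_OmegaE G)).
move=> _ [_ [[//|j] _ [A mA <-]] <-].
by have := mf j measurableT A mA; rewrite !setTI.
Qed.

Lemma measurable_upd k :
  measurable_fun setT ((fun p => upd p.1 k p.2) : O * G -> O).
Proof.
apply: measurable_toO => i; rewrite /upd; case: (i == k).
  exact: measurable_snd.
by apply: (measurableT_comp (measurable_coord i)); exact: measurable_fst.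
Qed.

Lemma measurable_upd1 k w : measurable_fun setT (upd w k : G -> O).
Proof.
apply: measurable_toO => i; rewrite /upd; case: (i == k) => //.
Qed.

End upd.

(* Existence of the infinite product measure mu^(x)N* on an arbitrary measurable
   space: coordinates are integrated out one at a time, which gives a content on
   the algebra of cylinders; it is continuous at the empty set by the
   Ionescu-Tulcea argument, hence extends by Caratheodory. The result,
   path_measure, is characterized by path_measureE and path_measure_unique. *)
Section product_construction.
Context d (G : measurableType d) (R : realType) (mu : probability G R).
Local Notation O := (Omega G).
Local Open Scope ereal_scope.

Implicit Types (f g : O -> \bar R) (A B : set O).

Let integral_one (c : \bar R) : \int[mu]_x cst c x = c.
Proof.
rewrite integral_cst// -[RHS]mule1; congr (_ * _); exact: probability_setT.
Qed.

Let good f := measurable_fun setT f /\ forall w, 0 <= f w <= 1.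

Definition integrate_coord k f : O -> \bar R :=
  fun w => \int[mu]_x f (upd w k x).

Fixpoint integrate_from j m f : O -> \bar R :=
  if m is m'.+1 then integrate_coord j (integrate_from j.+1 m' f) else f.

Let T := integrate_coord.
Let J := integrate_from.

Lemma integrate_coord_good k f : good f -> good (T k f).
Proof.
move=> [mf f01]; split.
  pose h (p : O * G) := f (upd p.1 k p.2).
  have mh : measurable_fun setT h.
    by apply: (measurableT_comp mf); exact: measurable_upd.
  by apply: (measurable_fun_fubini_tonelli_F h) => // p; case/andP: (f01 (upd p.1 k p.2)).
move=> w; apply/andP; split.
  by apply: integral_ge0 => x _; case/andP: (f01 (upd w k x)).
apply: (@le_trans _ _ (\int[mu]_x cst 1 x)); last first.
  by rewrite integral_cst// mul1e; exact: probability_le1.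
apply: ge0_le_integral => //.
- by move=> x _; case/andP: (f01 (upd w k x)).
- by apply: (measurableT_comp mf); exact: measurable_upd1.
- by move=> x _; case/andP: (f01 (upd w k x)).
Qed.

Lemma integrate_from_good m j f : good f -> good (J j m f).
Proof. by elim: m j => //= m IH j gf; apply: integrate_coord_good; exact: IH. Qed.

Let mgood f k w : good f -> measurable_fun setT (fun x => f (upd w k x)).
Proof. by move=> [mf _]; apply: (measurableT_comp mf); exact: measurable_upd1. Qed.

Lemma le_integrate_from m j f g : good f -> good g ->
  (forall w, f w <= g w) -> forall w, J j m f w <= J j m g w.
Proof.
move=> gf gg fg; elim: m j => //= m IH j w.
apply: ge0_le_integral => //.
- by move=> x _; case/andP: ((integrate_from_good m j.+1 gf).2 (upd w j x)).
- exact/mgood/integrate_from_good.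
- exact/mgood/integrate_from_good.
Qed.

Lemma integrate_fromD m j f g : good f -> good g ->
  forall w, J j m (f \+ g) w = J j m f w + J j m g w.
Proof.
move=> gf gg; elim: m j => //= m IH j w.
rewrite /integrate_coord; under eq_integral do rewrite IH.
rewrite ge0_integralD //.
- by move=> x _; case/andP: ((integrate_from_good m j.+1 gf).2 (upd w j x)).
- exact/mgood/integrate_from_good.
- by move=> x _; case/andP: ((integrate_from_good m j.+1 gg).2 (upd w j x)).
- exact/mgood/integrate_from_good.
Qed.

Definition depends_on n A :=
  forall w w' : O, (forall i, (i < n)%N -> w i = w' i) -> A w -> A w'.

Definition is_cylinder A := measurable A /\ exists n, depends_on n A.

Lemma depends_onW n m A : (n <= m)%N -> depends_on n A -> depends_on m A.
Proof.
by move=> nm dA w w' ww'; apply: dA => i il; apply: ww'; exact: leq_trans nm.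
Qed.

Lemma depends_onC n A : depends_on n A -> depends_on n (~` A).
Proof. by move=> dA w w' ww' nA /dA Aw; apply/nA/Aw => i /ww'. Qed.

Lemma depends_onU n A B : depends_on n A -> depends_on n B ->
  depends_on n (A `|` B).
Proof. by move=> dA dB w w' ww' [/dA|/dB] H; [left|right]; exact: H. Qed.

Let ind A : O -> \bar R := fun w => (\1_A w)%:E.

Lemma indicator_good A : measurable A -> good (ind A).
Proof.
move=> mA; split.
  by apply/measurable_EFinP; exact: measurable_indic.
by move=> w; rewrite /ind indicE; case: (w \in A); rewrite !lee_fin ?ler01 lexx.
Qed.

Lemma indicator_dep n A w w' : depends_on n A ->
  (forall i, (i < n)%N -> w i = w' i) -> ind A w = ind A w'.
Proof.
move=> dA ww'; rewrite /ind !indicE; congr (_%:R%:E); congr nat_of_bool.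
by apply/idP/idP => /set_mem h; apply/mem_set; apply: dA h => i /ww'.
Qed.

Lemma integrate_from_stable n A j m w : depends_on n A -> (n <= j + m)%N ->
  J j m.+1 (ind A) w = J j m (ind A) w.
Proof.
move=> dA; elim: m j w => [|m IH] j w nj.
  rewrite /= /T /integrate_coord.
  rewrite (eq_integral (cst (ind A w))).
    exact: integral_one.
  move=> x _; apply: (indicator_dep dA) => i il; rewrite /upd ifN//.
  by rewrite neq_ltn (leq_trans il)// -(addn0 j).
rewrite [LHS]/= [RHS]/=; apply: eq_integral => x _.
by apply: IH; rewrite addSnnS.
Qed.

Lemma integrate_from_const n A j m m' w : depends_on n A ->
  (n <= j + m)%N -> (m <= m')%N -> J j m' (ind A) w = J j m (ind A) w.
Proof.
move=> dA nm /subnK <-; elim: (m' - m)%N => // k IH.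
rewrite addSn (integrate_from_stable _ dA) //.
by rewrite (leq_trans nm)// leq_add2l leq_addl.
Qed.

Definition cyl_size A : nat := xget 0%N [set n | depends_on n A].

Definition partial_value j A : O -> \bar R := J j (cyl_size A - j) (ind A).

Let V := partial_value.

Lemma cyl_sizeP A : is_cylinder A -> depends_on (cyl_size A) A.
Proof. by move=> [_ [n dA]]; rewrite /cyl_size; case: xgetP => [m _ //|/(_ n)]. Qed.

Lemma partial_valueE n A j m w : is_cylinder A -> depends_on n A ->
  (n <= j + m)%N -> V j A w = J j m (ind A) w.
Proof.
move=> cA dA nm; rewrite /V /partial_value.
have dA' := cyl_sizeP cA.
rewrite -(@integrate_from_const (cyl_size A) A j _ (maxn m (cyl_size A - j)))//.
- by rewrite (integrate_from_const w dA nm)// leq_maxl.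
- by rewrite -leq_subLR.
- exact: leq_maxr.
Qed.

Lemma partial_value_good j A : measurable A -> good (V j A).
Proof. by move=> mA; exact/integrate_from_good/indicator_good. Qed.

Lemma partial_valueS j A w : is_cylinder A ->
  V j A w = \int[mu]_x V j.+1 A (upd w j x).
Proof.
move=> cA; have dA := cyl_sizeP cA.
rewrite (@partial_valueE _ _ _ (cyl_size A).+1 _ cA dA); last first.
  by rewrite addnS (leq_trans (leq_addl j _)).
rewrite /=; apply: eq_integral => x _.
by rewrite -(@partial_valueE _ _ _ (cyl_size A) _ cA dA)// leq_addl.
Qed.

Lemma partial_value_end n A w : is_cylinder A -> depends_on n A ->
  V n A w = ind A w.
Proof. by move=> cA dA; rewrite (@partial_valueE n _ _ 0%N)// addn0. Qed.

Lemma le_partial_value j A B w : is_cylinder A -> is_cylinder B ->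
  A `<=` B -> V j A w <= V j B w.
Proof.
move=> cA cB AB.
pose m := maxn (cyl_size A) (cyl_size B).
rewrite (@partial_valueE _ A _ m _ cA (cyl_sizeP cA)); last first.
  by rewrite (leq_trans (leq_maxl _ _) (leq_addl _ _)).
rewrite (@partial_valueE _ B _ m _ cB (cyl_sizeP cB)); last first.
  by rewrite (leq_trans (leq_maxr _ _) (leq_addl _ _)).
apply: le_integrate_from.
- exact: (indicator_good cA.1).
- exact: (indicator_good cB.1).
move=> {}w; rewrite /ind lee_fin !indicE.
have [/set_mem/AB/mem_set -> //|_] := boolP (w \in A).
by case: (w \in B).
Qed.

Lemma partial_valueU j A B w : is_cylinder A -> is_cylinder B ->
  is_cylinder (A `|` B) -> A `&` B = set0 -> V j (A `|` B) w = V j A w + V j B w.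
Proof.
move=> cA cB cAB AB0.
pose m := maxn (cyl_size (A `|` B)) (maxn (cyl_size A) (cyl_size B)).
rewrite (@partial_valueE _ A _ m _ cA (cyl_sizeP cA)); last first.
  by rewrite /m maxnCA (leq_trans (leq_maxl _ _) (leq_addl _ _)).
rewrite (@partial_valueE _ B _ m _ cB (cyl_sizeP cB)); last first.
  by rewrite /m maxnA (leq_trans (leq_maxr _ _) (leq_addl _ _)).
rewrite (@partial_valueE _ _ _ m _ cAB (cyl_sizeP cAB)); last first.
  by rewrite (leq_trans (leq_maxl _ _) (leq_addl _ _)).
rewrite -integrate_fromD; [|exact: (indicator_good cA.1)|exact: (indicator_good cB.1)].
congr (J j m _ w); apply/funext => {}w; rewrite /ind /= -EFinD; congr EFin.
rewrite !indicE in_setU.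
have := AB0; case: (boolP (w \in A)) => [/set_mem wA|_]; last by rewrite add0r.
case: (boolP (w \in B)) => [/set_mem wB|_]; last by rewrite addr0.
by move=> /seteqP[/(_ w)]/(_ (conj wA wB)).
Qed.

Lemma exists_above (g : nat -> G -> \bar R) (e : R) :
  (forall k, measurable_fun setT (g k)) -> (forall k x, 0 <= g k x <= 1) ->
  (forall x, nonincreasing_seq (g ^~ x)) ->
  (forall k, e%:E <= \int[mu]_x g k x) -> exists x, forall k, e%:E <= g k x.
Proof.
move=> mg g01 dg eg; apply: contrapT => /forallNP nex.
pose h x := ereal_inf (range (g ^~ x)).
have gh x : g ^~ x @ \oo --> h x by exact: ereal_nonincreasing_cvgn.
have mh : measurable_fun setT h.
  by apply: (emeasurable_fun_cvg g) => // x _; exact: gh.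
have h01 x : 0 <= h x <= 1.
  apply/andP; split.
    by apply: le_ereal_inf_tmp => _ [k _ <-]; case/andP: (g01 k x).
  by apply: (le_trans (ereal_inf_lbound (ex_intro2 _ _ 0%N I erefl))); case/andP: (g01 0%N x).
have hfin x : h x \is a fin_num.
  case/andP: (h01 x) => h0 h1; rewrite ge0_fin_numE//.
  by rewrite (le_lt_trans h1)// ltry.
have he x : h x < e%:E.
  have /existsNP[k /negP] := nex x; rewrite -ltNge; apply: le_lt_trans.
  by apply: ereal_inf_lbound; exists k.
have int1 : mu.-integrable setT (cst 1).
  exact: (finite_measure_integrable_cst mu 1%R).
have [ih _ cvgh] : [/\ mu.-integrable setT h,
    (\int[mu]_x `|g n x - h x|) @[n --> \oo] --> 0
  & (\int[mu]_x g n x) @[n --> \oo] --> \int[mu]_x h x].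
  apply: (@dominated_convergence _ _ _ mu setT measurableT g h (cst 1)) => //.
  - by apply: aeW => x _; exact: gh.
  - by apply: aeW => x k _ /=; case/andP: (g01 k x) => ? ?; rewrite gee0_abs.
have eh : e%:E <= \int[mu]_x h x.
  rewrite -(cvg_lim _ cvgh)//; apply: lime_ge; first by apply/cvg_ex; eexists; exact: cvgh.
  exact: nearW.
have ie : mu.-integrable setT (cst e%:E).
  exact: (finite_measure_integrable_cst mu e).
have D0 x : 0 <= e%:E - h x by rewrite sube_ge0 ?(ltW (he x)) ?hfin ?orbT.
have mD : measurable_fun setT (fun x => e%:E - h x) by exact: emeasurable_funB.
have : \int[mu]_x `|e%:E - h x| = 0.
  apply/eqP; rewrite eq_le; apply/andP; split; last exact: integral_ge0.
  under eq_integral do rewrite gee0_abs//.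
  rewrite integralB// integral_one sube_le0//.
move/(ae_eq_integral_abs _ measurableT) => /(_ mD) [N [mN N0 subN]].
have NT : N = setT.
  apply/seteqP; split=> // x _; apply: subN => /= /(_ I) /eqP.
  by rewrite sube_eq ?fin_num_adde_defr// add0e gt_eqF.
have := @probability_setT _ _ _ mu; rewrite -NT => muN.
by move/eqP: N0; rewrite [X in X == _]muN onee_eq0.
Qed.


Lemma is_cylinderC A : is_cylinder A -> is_cylinder (~` A).
Proof.
move=> [mA [n dA]]; split; first exact: measurableC.
by exists n; exact: depends_onC.
Qed.

Lemma is_cylinderU A B : is_cylinder A -> is_cylinder B ->
  is_cylinder (A `|` B).
Proof.
move=> [mA [n dA]] [mB [m dB]]; split; first exact: measurableU.
exists (maxn n m); apply: depends_onU.
- exact: depends_onW (leq_maxl n m) dA.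
- exact: depends_onW (leq_maxr n m) dB.
Qed.

Lemma is_cylinder0 : is_cylinder set0.
Proof. by split => //; exists 0%N. Qed.

Lemma is_cylinderI A B : is_cylinder A -> is_cylinder B ->
  is_cylinder (A `&` B).
Proof.
by move=> cA cB; rewrite -[A `&` B]setCK setCI; exact/is_cylinderC/is_cylinderU/is_cylinderC/cB/is_cylinderC.
Qed.

Lemma nonincreasing_cylinders (A : nat -> set O) (e : R) :
  (0 < e)%R -> (forall k, is_cylinder (A k)) ->
  (forall k l, (k <= l)%N -> A l `<=` A k) ->
  (forall k, e%:E <= V 0 (A k) point) -> exists w, forall k, A k w.
Proof.
move=> e0 cA dA eA.
pose P j w := forall k, e%:E <= V j (A k) w.
have step (jw : nat * O) : exists x,
    P jw.1 jw.2 -> P jw.1.+1 (upd jw.2 jw.1 x).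
  case: jw => j w /=; have [Pjw|] := pselect (P j w); last by exists point.
  have [||||x Px] := @exists_above (fun k x => V j.+1 (A k) (upd w j x)) e.
  - by move=> k; apply: mgood; exact: partial_value_good (cA k).1.
  - by move=> k x; exact: (partial_value_good j.+1 (cA k).1).2.
  - by move=> x k l kl; apply: le_partial_value => //; exact: dA.
  - by move=> k; rewrite -partial_valueS//; exact: Pjw.
  - by exists x.
have {step} [F PF] := choice step.
pose W := fix W j : O := if j is j'.+1 then upd (W j') j' (F (j', W j')) else point.
have PW j : P j (W j) by elim: j => [|j IH] //=; exact: (PF (j, W j)).
pose w : O := fun i => W i.+1 i.
have Ww n i : (i < n)%N -> W n i = w i.
  elim: n => // n IH; rewrite ltnS leq_eqVlt => /orP[/eqP ->//|il].
  by rewrite /= {1}/upd ltn_eqF// IH.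
exists w => k; have dk := cyl_sizeP (cA k).
apply: (dk _ _ (Ww (cyl_size (A k)))).
have := PW (cyl_size (A k)) k; rewrite (partial_value_end _ (cA k) dk) /ind lee_fin indicE.
case: (boolP (_ \in _)) => [/set_mem h _|_]; first exact: h.
by move=> /(lt_le_trans e0); rewrite ltxx.
Qed.

Definition cylinder_value A : \bar R := V 0 A point.

Lemma cylinder_value_ge0 A : 0 <= cylinder_value A.
Proof.
rewrite /cylinder_value /V /partial_value subn0.
elim: (cyl_size A) 0%N (point : O) => /= [|m IH] j w.
  by rewrite /ind lee_fin indicE.
exact: integral_ge0.
Qed.

Lemma cylinder_value_le1 A : is_cylinder A -> cylinder_value A <= 1.
Proof. by move=> cA; case/andP: ((partial_value_good 0 cA.1).2 point). Qed.

Lemma cylinder_value0 : cylinder_value set0 = 0.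
Proof.
rewrite /cylinder_value (partial_value_end _ is_cylinder0 (n := 0))//.
by rewrite /ind indicE in_set0.
Qed.

Lemma cylinder_valueT : cylinder_value setT = 1.
Proof.
have cT : is_cylinder setT by rewrite -setC0; exact/is_cylinderC/is_cylinder0.
rewrite /cylinder_value (partial_value_end _ cT (n := 0))//.
by rewrite /ind indicE in_setT.
Qed.

Definition cylType : Type := O.
HB.instance Definition _ := Pointed.on cylType.


HB.instance Definition _ := @isAlgebraOfSets.Build default_measure_display
  cylType is_cylinder is_cylinder0 is_cylinderU is_cylinderC.

Definition cylinder_content : set cylType -> \bar R := cylinder_value.

Let cc0 : cylinder_content set0 = 0. Proof. exact: cylinder_value0. Qed.
Let cc_ge0 A : 0 <= cylinder_content A. Proof. exact: cylinder_value_ge0. Qed.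

Let cc_sigma : semi_sigma_additive cylinder_content.
Proof.
move=> F mF tF mUF.
have cF i : is_cylinder (F i) := mF i.
have cUF : is_cylinder (\bigcup_n F n) := mUF.
pose S n := \bigcup_(i < n) F i : set O.
have cS n : is_cylinder (S n).
  elim: n => [|n IH].
    by rewrite /S II0 bigcup_set0; exact: is_cylinder0.
  by rewrite /S IIS bigcup_setU bigcup_set1; apply: is_cylinderU => //; exact: cF.
pose B n := (\bigcup_n F n) `\` S n : set O.
have cB n : is_cylinder (B n).
  by rewrite /B setDE; apply: is_cylinderI => //; exact: is_cylinderC.
have valS n : cylinder_content (S n) = \sum_(0 <= i < n) cylinder_content (F i).
  elim: n => [|n IH].
    by rewrite /S II0 bigcup_set0 big_nil.
  rewrite big_nat_recr//= -IH /S IIS bigcup_setU bigcup_set1.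
  apply: (partial_valueU _ _ (cS n) (cF n)); first exact: (is_cylinderU (cS n) (cF n)).
  apply/seteqP; split => // w [[i /= il Fiw] Fnw].
  have := tF i n I I (ex_intro _ w (conj Fiw Fnw)).
  by move=> iN; move: il; rewrite iN ltnn.
have valU n : cylinder_content (\bigcup_n F n) =
    cylinder_content (S n) + cylinder_content (B n).
  have UE : \bigcup_n F n = S n `|` B n.
    by rewrite /B setDUK// => w [i _ Fiw]; exists i.
  rewrite {1}UE; apply: partial_valueU => //; first by rewrite -UE.
  by rewrite /B setDIK.
have B_dec k l : (k <= l)%N -> B l `<=` B k.
  move=> kl w [Uw nSw]; split=> // -[i /= ik Fiw]; apply: nSw.
  by exists i => //=; exact: leq_trans kl.
have fin A : is_cylinder A -> cylinder_content A \is a fin_num.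
  move=> cA; rewrite ge0_fin_numE; last exact: cc_ge0.
  by rewrite (le_lt_trans (cylinder_value_le1 cA))// ltry.
have cvgB : cylinder_content (B n) @[n --> \oo] --> 0.
  have ni : nonincreasing_seq (cylinder_content \o B).
    by move=> k l kl; apply: le_partial_value => //; exact: B_dec.
  have := ereal_nonincreasing_cvgn ni; set l := ereal_inf _ => cvgl.
  have l0 : 0 <= l by apply: le_ereal_inf_tmp => _ [k _ <-]; exact: cc_ge0.
  have lB k : l <= cylinder_content (B k) by apply: ereal_inf_lbound; exists k.
  have lfin : l \is a fin_num.
    by rewrite ge0_fin_numE// (le_lt_trans (lB 0%N))// -ge0_fin_numE ?fin.
  move: l0; rewrite le_eqVlt => /orP[/eqP ->//|l0].
  exfalso; have [||||w Bw] := @nonincreasing_cylinders B (fine l) => //.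
  - by rewrite fine_gt0// l0 ltey_eq lfin.
  - by move=> k; rewrite fineK//; exact: lB.
  - have [[i _ Fiw] _] := Bw 0%N.
    by have [_] := Bw i.+1; apply; exists i => /=.
have -> : (fun n => \sum_(0 <= i < n) cylinder_content (F i)) =
    (fun n => cylinder_content (\bigcup_n F n) - cylinder_content (B n)).
  by apply/funext => n; rewrite -valS (valU n) addeK//; exact: fin.
rewrite -[X in _ --> X]sube0; apply: cvgeB => //; last exact: cvg_cst.
by rewrite fin_num_adde_defl.
Qed.

HB.instance Definition _ := isMeasure.Build _ _ _ cylinder_content
  cc0 cc_ge0 cc_sigma.


Let cyl_sigma : Type := g_sigma_algebraType (@measurable _ cylType).

Lemma measurable_cyl_sigma A : measurable A -> @measurable _ cyl_sigma A.
Proof.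
suff : @measurable _ O `<=` @measurable _ cyl_sigma by exact.
apply: smallest_sub; first exact: smallest_sigma_algebra.
move=> _ [[//|j] _ [B mB <-]]; apply: sub_sigma_algebra; split.
  by apply: measurable_coord.
by exists j.+1 => w w' ww' [_ Bw]; split => //; rewrite /= /X /= -ww'.
Qed.

Definition product_measure_fun : set O -> \bar R :=
  measure_extension cylinder_content.

Let pm0 : product_measure_fun set0 = 0.
Proof. exact: (measure0 (measure_extension cylinder_content)). Qed.

Let pm_ge0 A : 0 <= product_measure_fun A.
Proof. exact: (measure_ge0 (measure_extension cylinder_content)). Qed.

Let pm_sigma : semi_sigma_additive product_measure_fun.
Proof.
move=> F mF tF mUF.
have mF' i := measurable_cyl_sigma (mF i).
have mUF' := measurable_cyl_sigma mUF.
exact: (@measure_semi_sigma_additive _ _ _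
  (measure_extension cylinder_content) F mF' tF mUF').
Qed.

HB.instance Definition _ := isMeasure.Build _ _ _ product_measure_fun
  pm0 pm_ge0 pm_sigma.

Let product_measureE A : is_cylinder A ->
  product_measure_fun A = cylinder_value A.
Proof. by move=> cA; exact: (@measurable_mu_extE _ _ _ cylinder_content A cA). Qed.

Let pmT : product_measure_fun setT = 1.
Proof.
rewrite product_measureE ?cylinder_valueT//.
by rewrite -setC0; exact/is_cylinderC/is_cylinder0.
Qed.

HB.instance Definition _ := Measure_isProbability.Build _ _ _
  product_measure_fun pmT.

Let box (A : nat -> set G) n : set O := [set w | forall i, (i < n)%N -> A i (w i)].

Let box_cylinder (A : nat -> set G) n :
  (forall i, measurable (A i)) -> is_cylinder (box A n).
Proof.
move=> mA; split; last first.
  by exists n => w w' ww' Aw i il; rewrite -ww'//; exact: Aw.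
have -> : box A n = \bigcap_(i < n) ((fun w : O => w i) @^-1` A i) by [].
apply: bigcap_measurableType => // i _; rewrite -[X in measurable X]setTI.
exact: measurable_coord.
Qed.

Let box_value (A : nat -> set G) n j w : (forall i, measurable (A i)) ->
  (j <= n)%N ->
  V j (box A n) w = (\1_(box A j) w)%:E * \prod_(j <= i < n) mu (A i).
Proof.
move=> mA jn; have cb := box_cylinder n mA.
have db : depends_on n (box A n).
  by move=> u u' uu' Au i il; rewrite -uu'//; exact: Au.
rewrite -(subKn jn); move: (n - j)%N (leq_subr j n) => m.
elim: m w => [|m IH] w mn.
  by rewrite subn0 partial_value_end// big_geq// mule1.
have nmS : (n - m.+1).+1 = (n - m)%N by rewrite subnSK.
set k := (n - m.+1)%N in nmS *.
rewrite partial_valueS// nmS; under eq_integral do rewrite (IH _ (ltnW mn)).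
have ind_upd x : (\1_(box A (n - m)) (upd w k x))%:E =
    (\1_(box A k) w)%:E * (\1_(A k) x)%:E :> \bar R.
  rewrite -nmS -EFinM !indicE -natrM mulnb; congr (nat_of_bool _)%:R%:E.
  apply/idP/andP => [/set_mem Aw|[/set_mem Aw /set_mem Ax]].
    split; apply/mem_set.
      by move=> i ik; have := Aw i (ltnW ik); rewrite /upd ltn_eqF.
    by have := Aw k (ltnSn k); rewrite /upd eqxx.
  apply/mem_set => i; rewrite ltnS leq_eqVlt => /orP[/eqP ->|ik].
    by rewrite /upd eqxx.
  by rewrite /upd ltn_eqF//; exact: Aw.
have p0 : 0 <= \prod_(n - m <= i < n) mu (A i) by apply: prode_ge0.
under eq_integral do rewrite ind_upd -muleA (muleC (_ %:E) (\prod_(_ <= _ < _) _)) muleA.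
have mAk : measurable_fun setT (fun x => (\1_(A k) x)%:E : \bar R).
  by apply/measurable_EFinP; exact: measurable_indic.
rewrite (ge0_integralZl _ measurableT mAk); last 2 first.
- by move=> x _; rewrite lee_fin.
- by rewrite mule_ge0// lee_fin.
rewrite integral_indic// setIT -muleA; congr (_ * _).
rewrite [RHS]big_ltn; last by rewrite -(ltn_add2r m.+1) subnK// -[ltnLHS]addn0 ltn_add2l.
by rewrite nmS muleC.
Qed.

Lemma product_measure_box n (A : nat -> set G) : (forall i, measurable (A i)) ->
  product_measure_fun [set w | forall i, (i < n)%N -> A i (w i)] =
  \prod_(i < n) mu (A i).
Proof.
move=> mA; rewrite (product_measureE (box_cylinder n mA)) /cylinder_value.
rewrite box_value// indicE mem_set ?mul1e ?big_mkord//.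
Qed.

Definition path_measure : probability O R := product_measure_fun.

Lemma path_measureE n (A : nat -> set G) : (forall i, measurable (A i)) ->
  path_measure [set w | forall i, (i < n)%N -> A i (w i)] =
  \prod_(i < n) mu (A i).
Proof. exact: product_measure_box. Qed.

Lemma path_measure_unique (P : probability O R) :
  (forall n (A : nat -> set G), (forall i, measurable (A i)) ->
    P [set w | forall i, (i < n)%N -> A i (w i)] = \prod_(i < n) mu (A i)) ->
  forall B, measurable B -> P B = path_measure B.
Proof.
move=> PE; pose boxes := [set B : set O | exists n (A : nat -> set G),
  (forall i, measurable (A i)) /\ B = box A n].
apply: (measure_unique boxes (fun=> setT)).
- apply/seteqP; split; last first.
    apply: smallest_sub; first exact: sigma_algebra_measurable.
    by move=> _ [n [A [mA ->]]]; case: (box_cylinder n mA).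
  apply: smallest_sub; first exact: smallest_sigma_algebra.
  move=> _ [[//|j] _ [B mB <-]]; apply: sub_sigma_algebra.
  exists j.+1, (fun i => if i == j then B else setT); split.
    by move=> i; case: ifP.
  rewrite setTI; apply/seteqP; split => w /=.
    by move=> Bw i _; case: eqP => // ->.
  by move=> /(_ j (ltnSn j)); rewrite eqxx.
- move=> _ _ [n [A [mA ->]]] [m [B [mB ->]]].
  exists (maxn n m), (fun i => (if (i < n)%N then A i else setT) `&`
                               (if (i < m)%N then B i else setT)); split.
    by move=> i; apply: measurableI; case: ifP.
  apply/seteqP; split => w /=.
    by move=> [Aw Bw] i _; split; case: ifP => // il; [exact: Aw|exact: Bw].
  move=> ABw; split => i il.
    have /ABw[] : (i < maxn n m)%N by rewrite leq_max il.
    by rewrite il.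
  have /ABw[_] : (i < maxn n m)%N by rewrite leq_max il orbT.
  by rewrite il.
- by move=> _; exists 0%N, (fun=> setT); split => //; apply/seteqP; split.
- by apply/seteqP; split => // w _; exists 0%N.
- by move=> _ [n [A [mA ->]]]; rewrite [LHS]PE// [RHS]path_measureE.
- by move=> _; rewrite (le_lt_trans (probability_le1 P measurableT))// ltry.
Qed.

End product_construction.

Section cocycles.
Context d (G : measurableType d) (R : realType).
Implicit Types (mu : probability G R) (Q : nat -> Omega G -> R).

Definition defective_adapted_cocycle Q :=
  (forall w, Q 0%N w = 0) /\
  forall n, (0 < n)%N ->
    measurable_fun setT (Q n : g_sigma_algebraType (past G n) -> R).

Definition defect Q n m (w : Omega G) : R :=
  Q (n + m)%N w - Q n w - Q m (shift n w).

Definition finite_second_moment mu Q :=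
  ('E_(path_measure mu)[fun w => (`|Q 1%N w| ^+ 2)%R] < +oo)%E.

Definition second_moment_deviation mu Q :=
  (ereal_sup [set 'E_(path_measure mu)[fun w => (`|defect Q n m w| ^+ 2)%R] |
              n in [set: nat] & m in [set: nat]] < +oo)%E.

Definition uniform_first_moment_deviation (mu_ : R -> probability G R) Q :=
  (ereal_sup [set ereal_sup [set 'E_(path_measure (mu_ t))[fun w => `|defect Q n m w|%R] |
                    n in [set: nat] & m in [set: nat]] |
              t in `[0%R, 1%R]] < +oo)%E.

(* lim is a default value when there is no limit; convergence follows from
   integrability of Q 1 and the first-moment deviation inequality. *)
Definition rate_of_escape mu Q : R :=
  lim (n%:R^-1 * fine 'E_(path_measure mu)[Q n] @[n --> \oo]).

Definition score_covariation (nu : G -> R) mu Q (n : nat) : R :=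
  n%:R^-1 * fine 'E_(path_measure mu)[fun w =>
    (Q n w * \sum_(1 <= j < n.+1) nu (X j w))%R].

Definition sigma (nu : G -> R) mu Q : R :=
  lim (score_covariation nu mu Q n @[n --> \oo]).

(* f is a version of the Radon-Nikodym derivative d mu' / d mu. *)
Definition is_density mu' mu (f : G -> R) :=
  [/\ measurable_fun setT f, (forall a, 0 <= f a) &
      forall A, measurable A -> mu' A = (\int[mu]_(a in A) (f a)%:E)%E].

End cocycles.

(* Main.v *)
(** Write [N_n = nu(X_1) + ... + nu(X_n)], [M_n] for the density of [mu_t]
    with respect to [mu] along the first [n] increments, and [C_n] for
    [E[Q_n N_n]]. The second-moment deviation inequality gives
    [Var Q_n = O(n)] and [C_(n+m) = C_n + C_m + O(sqrt (n + m))], so that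
    [C_n / n] converges, while the uniform first-moment inequality gives
    [l(mu_t) = E^t[Q_n] / n + O(1/n)] uniformly in [t]. Since
    [E^t[Q_n] - E[Q_n] = E[(Q_n - E[Q_n]) (M_n - 1)]], where
    [M_n - 1 - t N_n] has L^2-norm [O(n t^2) + o(sqrt n t)], the difference of
    [(l(mu_t) - l(mu)) / t] and [C_n / n] is
    [O(1 / (n t)) + O(sqrt n t) + o(1)] as [t] tends to 0, and one lets
    [n t] tend to infinity and [n t^2] to 0. *)
Require Import Defs.
From HB Require Import structures.
From mathcomp Require Import all_boot all_order all_algebra.
From mathcomp Require Import all_classical all_reals all_analysis.
From mathcomp Require Import measurable_realfun.
From mathcomp Require Import ring lra zify.

Import Order.TTheory GRing.Theory Num.Theory.
Import numFieldNormedType.Exports.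

Local Open Scope classical_set_scope.
Local Open Scope ring_scope.

Local Notation shift := Defs.shift.

Set Implicit Arguments.
Unset Strict Implicit.

(** Second moments are controlled under [mu] only, so every L^2 estimate is made under [mu]; a law
    [mu_ t] enters through the density of finitely many coordinates and through first moments of
    defects.

    Centring Q_n is what makes the scales compatible. Q_n itself may have L^2-norm of order n;
    against a remainder of norm O(n t^2) this would leave O(n t) after division by n t, which is
    useless when n t is large. The centred Q_n has norm O(sqrt n) and leaves sqrt n t.

    All cross terms vanish for one reason: a function of the first n coordinates is independent of a
    function of the path shifted by n. In particular M_n is a martingale with orthogonal increments,
    so it is expanded by recursions on second moments and not by multiplying out the product. The
    expansion is made in f_t - 1, which has mean exactly 0; only afterwards is (f_t - 1) / t
    replaced by nu, at the cost of the L^2-norm of a function of one coordinate. That nu is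
    measurable and has mean 0 under [mu] is itself deduced from the convergence of these
    quotients. *)

Lemma probability_integral_cst d (T : measurableType d) (R : realType)
    (P : probability T R) (c : \bar R) : (\int[P]_x c = c)%E.
Proof.
rewrite integral_cst// -[RHS]mule1; congr (_ * _)%E; exact: probability_setT.
Qed.

(** [f] and the Radon-Nikodym derivative have the same integral over every measurable set, hence
    agree almost everywhere. *)
Lemma ge0_integral_density d (T : measurableType d) (R : realType)
    (mu' mu : probability T R) (f : T -> R) (h : T -> \bar R) :
  mu' `<< mu -> is_density mu' mu f ->
  measurable_fun setT h -> (forall x, 0 <= h x)%E ->
  (\int[mu']_x h x = \int[mu]_x (h x * (f x)%:E))%E.
Proof.
move=> ac [mf f0 fE] mh h0.
rewrite -(Radon_Nikodym_SigmaFinite.change_of_variables ac h0 measurableT mh).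
have iF := Radon_Nikodym_SigmaFinite.f_integrable ac.
have mF := measurable_int mu iF.
have mf' : measurable_fun setT (EFin \o f) by exact/measurable_EFinP.
apply: ae_eq_integral => //; try exact: emeasurable_funM.
apply: ae_eqe_mul2l; apply: integral_ae_eq => // A _ mA.
by rewrite -(Radon_Nikodym_SigmaFinite.f_integral ac mA) -fE.
Qed.

(** * Adapted functions, splitting off the first coordinate, and independence of past and future *)

Section path_space.
Context d (G : measurableType d).
Local Notation O := (Omega G).

(** Adaptedness is used in this pointwise form, next to plain measurability, because it is stable
    under fixing the first coordinate and so suits inductions on [n]. *)
Definition depends (T : Type) n (F : O -> T) :=
  forall w w' : O, (forall i, (i < n)%N -> w i = w' i) -> F w = F w'.

(** The sets determined by the first [n] coordinates form a sigma-algebra that contains the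
    generators. *)
Lemma past_depends n (A : set O) :
  <<s past G n >> A -> depends n (fun w => A w : Prop).
Proof.
have sa : sigma_algebra setT [set A : set O | depends n (fun w => A w : Prop)].
  split=> [//|B dB w w' ww' /=|F dF w w' ww'].
    by rewrite /setD /= (dB _ _ ww').
  by apply/propext; split => -[i _ Fi]; exists i => //;
    move: Fi; rewrite (dF i _ _ ww').
apply: (smallest_sub sa) => _ [[//|j] /= jn [B mB <-]] w w' ww' /=.
by rewrite /setI /preimage /X /= ww'.
Qed.

Lemma past_measurable n (A : set O) : <<s past G n >> A -> measurable A.
Proof.
apply: (smallest_sub (@sigma_algebra_measurable _ O)).
move=> _ [j /= /andP[j0 _] [B mB <-]]; apply: sub_sigma_algebra.
by exists j => //; exists B.
Qed.

Lemma past_measurable_fun (R : realType) n (F : O -> R) :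
  measurable_fun setT (F : g_sigma_algebraType (past G n) -> R) ->
  measurable_fun setT F /\ depends n F.
Proof.
move=> mF; split.
  by move=> _ B mB; have /past_measurable := mF measurableT B mB.
(* The level set of [F] through [w] is an event of the past, hence contains [w'] as well. *)
move=> w w' ww'; have := mF measurableT [set F w] (measurable_set1 _).
rewrite setTI => /past_depends /(_ w w' ww') /= e.
by have : F w' = F w by rewrite -e.
Qed.

Lemma measurable_shift n : measurable_fun setT (shift n : O -> O).
Proof. by apply: measurable_toO => i; exact: measurable_coord. Qed.

(** Prepending a coordinate carries [mu \x P] to [P], which turns statements on [n] coordinates into
    inductions with one application of Tonelli per step. *)
Definition cons_path (p : G * O) : O := fun i => if i is j.+1 then p.2 j else p.1.

Lemma measurable_cons_path : measurable_fun setT cons_path.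
Proof.
apply: measurable_toO => -[|i]; first exact: measurable_fst.
by apply: (measurableT_comp (measurable_coord i)); exact: measurable_snd.
Qed.

HB.instance Definition _ :=
  isMeasurableFun.Build _ _ _ _ cons_path measurable_cons_path.

Lemma depends_cons_path (T : Type) n (F : O -> T) x :
  depends n.+1 F -> depends n (fun w => F (cons_path (x, w))).
Proof. by move=> dF w w' ww'; apply: dF => -[|i] //= /ww'. Qed.

Context {R : realType}.
Implicit Types mu : probability G R.
Local Open Scope ereal_scope.

Section one_measure.
Variable mu : probability G R.
Local Notation P := (path_measure mu).

Lemma path_measure_cons (B : set O) : measurable B ->
  distribution (mu \x P) cons_path B = P B.
Proof.
move: B.
apply: (@path_measure_unique _ _ _ mu (distribution (mu \x P) cons_path)).
move=> n A mA.
rewrite /distribution /pushforward.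
case: n => [|n].
  rewrite big_ord0 -(probability_setT (mu \x P)).
  by congr ((mu \x P) _); apply/seteqP.
pose B : set O := [set w | forall i, (i < n)%N -> A i.+1 (w i)].
have mB : measurable B.
  have -> : B = \bigcap_(i < n) ((fun w : O => w i) @^-1` A i.+1) by [].
  apply: bigcap_measurableType => // i _; rewrite -[X in measurable X]setTI.
  exact: measurable_coord.
have consE : cons_path @^-1` [set w | forall i, (i < n.+1)%N -> A i (w i)] =
    A 0%N `*` B.
  apply/seteqP; split => -[x w] /=.
    by move=> Axw; split; [exact: (Axw 0%N)|move=> i il; exact: (Axw i.+1)].
  by move=> [Ax Bw] [|i] //= il; exact: Bw.
transitivity ((mu \x P) (A 0%N `*` B)); first by rewrite -consE.
rewrite product_measure1E// big_ord_recl; congr (_ * _).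
exact: (path_measureE mu n (fun i => mA i.+1)).
Qed.

Lemma integral_path_cons (F : O -> \bar R) :
  measurable_fun setT F -> (forall w, 0 <= F w) ->
  \int[P]_w F w = \int[mu]_x \int[P]_w F (cons_path (x, w)).
Proof.
move=> mF F0.
transitivity (\int[distribution (mu \x P) cons_path]_w F w).
  by apply: eq_measure_integral => A mA _; exact/esym/path_measure_cons.
rewrite ge0_integral_distribution// fubini_tonelli1 => [//||p]; last exact: F0.
by apply: (measurableT_comp mF); exact: measurable_cons_path.
Qed.

Lemma measurable_cons_path1 (F : O -> \bar R) x : measurable_fun setT F ->
  measurable_fun setT (fun w => F (cons_path (x, w))).
Proof.
move=> mF; apply: (measurableT_comp mF).
by apply: (measurableT_comp measurable_cons_path).
Qed.

Lemma measurable_integral_cons (F : O -> \bar R) :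
  measurable_fun setT F -> (forall w, 0 <= F w) ->
  measurable_fun setT (fun x => \int[P]_w F (cons_path (x, w))).
Proof.
move=> mF F0; apply: (measurable_fun_fubini_tonelli_F (F \o cons_path)) => //=.
by apply: (measurableT_comp mF); exact: measurable_cons_path.
Qed.

(** Induction on [n]: once the first coordinate [x] is integrated separately, [shift n.+1] of the
    path with [x] prepended is [shift n] of the rest, and [U] depends on one coordinate less. *)
Lemma ge0_integral_indep n (U V : O -> \bar R) :
  measurable_fun setT U -> measurable_fun setT V ->
  (forall w, 0 <= U w) -> (forall w, 0 <= V w) -> depends n U ->
  \int[P]_w (U w * V (shift n w)) = \int[P]_w U w * \int[P]_w V w.
Proof.
elim: n U => [|n IH] U mU mV U0 V0 dU.
  have Uc w : U w = U point by exact: dU.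
  under eq_integral do rewrite Uc.
  under [in RHS]eq_integral do rewrite Uc.
  by rewrite ge0_integralZl// probability_integral_cst.
have mVs : measurable_fun setT (fun w : O => V (shift n.+1 w)).
  by apply: (measurableT_comp mV); exact: measurable_shift.
rewrite integral_path_cons; last 2 first.
- exact: emeasurable_funM.
- by move=> w; rewrite mule_ge0.
transitivity (\int[mu]_x ((\int[P]_w U (cons_path (x, w))) * \int[P]_w V w)).
  apply: eq_integral => x _; rewrite -IH//.
  - exact: measurable_cons_path1.
  - exact: depends_cons_path.
rewrite ge0_integralZr//.
- by rewrite -integral_path_cons.
- exact: measurable_integral_cons.
- by move=> x _; apply: integral_ge0.
- exact: integral_ge0.
Qed.

End one_measure.

(** The law is exchanged one coordinate at a time: the induction hypothesis treats the tail, the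
    one-step density the first coordinate. *)
Lemma ge0_integral_path_density mu' mu (f : G -> R) n (F : O -> \bar R) :
  mu' `<< mu -> is_density mu' mu f ->
  measurable_fun setT F -> (forall w, 0 <= F w) -> depends n F ->
  \int[path_measure mu']_w F w =
  \int[path_measure mu]_w (F w * (\prod_(i < n) f (w i))%:E).
Proof.
move=> ac fd; have [mf f0 fE] := fd.
elim: n F => [|n IH] F mF F0 dF.
  have Fc w : F w = F point by exact: dF.
  under eq_integral do rewrite Fc.
  under [in RHS]eq_integral do rewrite Fc big_ord0 mule1.
  by rewrite !probability_integral_cst.
have mprod m : measurable_fun setT (fun w : O => (\prod_(i < m) f (w i))%:E).
  apply/measurable_EFinP; apply: measurable_prod => i _.
  by apply: (measurableT_comp mf); exact: measurable_coord.
have prod0 m (w : O) : 0 <= (\prod_(i < m) f (w i))%:E.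
  by rewrite lee_fin prodr_ge0.
rewrite integral_path_cons//.
have mFx x : measurable_fun setT (fun w => F (cons_path (x, w))).
  exact: measurable_cons_path1.
transitivity (\int[mu']_x \int[path_measure mu]_w
    (F (cons_path (x, w)) * (\prod_(i < n) f (w i))%:E)).
  by apply: eq_integral => x _; rewrite -IH//; exact: depends_cons_path.
have mFp : measurable_fun setT (fun w : O => F w * (\prod_(i < n) f (w i.+1))%:E).
  apply: emeasurable_funM => //.
  exact: (measurableT_comp (mprod n) (measurable_shift 1)).
rewrite (ge0_integral_density ac fd); last 2 first.
- apply: (measurable_integral_cons _ mFp).
  by move=> w; rewrite mule_ge0// lee_fin prodr_ge0.
- by move=> x; apply: integral_ge0 => w _; rewrite mule_ge0.
rewrite [RHS]integral_path_cons; last 2 first.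
- exact: emeasurable_funM.
- by move=> w; rewrite mule_ge0.
apply: eq_integral => x _; rewrite -ge0_integralZr//.
- apply: eq_integral => w _; rewrite -muleA; congr (_ * _).
  by rewrite -EFinM mulrC [in RHS]big_ord_recl.
- exact: emeasurable_funM.
- by move=> w _; rewrite mule_ge0.
- by rewrite lee_fin.
Qed.

End path_space.

(** * Integrable and square-integrable real functions, Cauchy-Schwarz *)

Section square_integrable.
Context d (T : measurableType d) (R : realType) (P : probability T R).
Implicit Types (F H : T -> R) (c : R).

Definition L1 F := P.-integrable setT (EFin \o F).

Definition L2 F := measurable_fun setT F /\ L1 (fun x => F x ^+ 2).

Definition norm2 F : R := Num.sqrt (\int[P]_x (F x ^+ 2)).

Lemma L1_measurable F : L1 F -> measurable_fun setT F.
Proof. by move=> /measurable_int /measurable_EFinP. Qed.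

Lemma L1_le F H : measurable_fun setT F -> L1 H ->
  (forall x, `|F x| <= H x) -> L1 F.
Proof.
move=> mF iH FH; apply: (le_integrable measurableT _ _ iH).
  exact/measurable_EFinP.
by move=> x _; rewrite /= lee_fin (le_trans (FH x))// ler_norm.
Qed.

Lemma L1_cst c : L1 (fun=> c).
Proof. exact: finite_measure_integrable_cst. Qed.

Lemma L1_bounded F c : measurable_fun setT F -> (forall x, `|F x| <= c) -> L1 F.
Proof. by move=> mF; apply: L1_le => //; exact: L1_cst. Qed.

Lemma L1D F H : L1 F -> L1 H -> L1 (fun x => F x + H x).
Proof. by move=> iF iH; exact: (integrableD measurableT iF iH). Qed.

Lemma L1B F H : L1 F -> L1 H -> L1 (fun x => F x - H x).
Proof. by move=> iF iH; exact: (integrableB measurableT iF iH). Qed.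

Lemma L1Zl c F : L1 F -> L1 (fun x => c * F x).
Proof. by move=> iF; exact: (integrableZl measurableT c iF). Qed.

Lemma L1_norm F : L1 F -> L1 (fun x => `|F x|).
Proof. by move=> iF; exact: (integrable_abse iF). Qed.

Lemma L1_sum (I : Type) (s : seq I) (F : I -> T -> R) :
  (forall i, L1 (F i)) -> L1 (fun x => \sum_(i <- s) F i x).
Proof.
move=> iF; elim: s => [|i s IH].
  by under eq_fun do rewrite big_nil; exact: L1_cst.
by under eq_fun do rewrite big_cons; exact: L1D.
Qed.

Lemma Rexp_cst c : \int[P]_x c = c.
Proof. by rewrite /Rintegral probability_integral_cst. Qed.

Lemma RexpD F H : L1 F -> L1 H ->
  \int[P]_x (F x + H x) = \int[P]_x F x + \int[P]_x H x.
Proof. by move=> iF iH; rewrite RintegralD. Qed.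

Lemma RexpB F H : L1 F -> L1 H ->
  \int[P]_x (F x - H x) = \int[P]_x F x - \int[P]_x H x.
Proof. by move=> iF iH; rewrite RintegralB. Qed.

Lemma RexpZl c F : L1 F -> \int[P]_x (c * F x) = c * \int[P]_x F x.
Proof. by move=> iF; rewrite RintegralZl. Qed.

Lemma Rexp_sum (I : Type) (s : seq I) (F : I -> T -> R) :
  (forall i, L1 (F i)) ->
  \int[P]_x (\sum_(i <- s) F i x) = \sum_(i <- s) \int[P]_x F i x.
Proof.
move=> iF; elim: s => [|i s IH].
  by under eq_Rintegral do rewrite big_nil; rewrite Rexp_cst big_nil.
under eq_Rintegral do rewrite big_cons.
by rewrite RexpD ?IH ?big_cons//; exact: L1_sum.
Qed.

Lemma le_Rexp F H : L1 F -> L1 H -> (forall x, F x <= H x) ->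
  \int[P]_x F x <= \int[P]_x H x.
Proof. by move=> iF iH FH; apply: le_Rintegral. Qed.

Lemma Rexp_ge0 F : (forall x, 0 <= F x) -> 0 <= \int[P]_x F x.
Proof. by move=> F0; apply: Rintegral_ge0. Qed.

Lemma ler_norm_Rexp F : L1 F -> `|\int[P]_x F x| <= \int[P]_x `|F x|.
Proof. by move=> iF; apply: le_normr_Rintegral. Qed.

Lemma integral_RexpE F : L1 F -> (\int[P]_x (F x)%:E)%E = (\int[P]_x F x)%:E.
Proof. by move=> iF; rewrite /Rintegral fineK// integrable_fin_num. Qed.

Lemma L2_measurable F : L2 F -> measurable_fun setT F. Proof. by case. Qed.

Lemma L2M F H : L2 F -> L2 H -> L1 (fun x => F x * H x).
Proof.
move=> [mF iF] [mH iH]; apply: (L1_le _ (L1D iF iH)).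
  exact: measurable_funM.
move=> x; rewrite normrM -(real_normK (num_real (F x))).
rewrite -(real_normK (num_real (H x))).
have := sqr_ge0 (`|F x| - `|H x|); have := normr_ge0 (F x).
have := normr_ge0 (H x); nra.
Qed.

Lemma L2_cst c : L2 (fun=> c).
Proof. by split; [exact: measurable_cst|exact: L1_cst]. Qed.

Lemma L2_L1 F : L2 F -> L1 F.
Proof.
move=> L2F; have := L2M (L2_cst 1) L2F; congr (L1 _).
by apply/funext => x; rewrite mul1r.
Qed.

Lemma L2_bounded F c : measurable_fun setT F -> (forall x, `|F x| <= c) -> L2 F.
Proof.
move=> mF Fc; split => //; apply: (@L1_bounded _ (c ^+ 2)).
  exact: measurable_funX.
move=> x; rewrite normrX lerXn2r ?nnegrE//; exact: le_trans (normr_ge0 _) (Fc x).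
Qed.

Lemma L2D F H : L2 F -> L2 H -> L2 (fun x => F x + H x).
Proof.
move=> LF LH; have [mF iF] := LF; have [mH iH] := LH; split.
  exact: measurable_funD.
have := L1D (L1D iF iH) (L1Zl 2 (L2M LF LH)); congr (L1 _).
by apply/funext => x; ring.
Qed.

Lemma L2Zl c F : L2 F -> L2 (fun x => c * F x).
Proof.
move=> [mF iF]; split; first exact: measurable_funM.
have := L1Zl (c ^+ 2) iF; congr (L1 _).
by apply/funext => x; rewrite exprMn.
Qed.

Lemma L2B F H : L2 F -> L2 H -> L2 (fun x => F x - H x).
Proof.
move=> LF LH; have := L2D LF (L2Zl (-1) LH); congr (L2 _).
by apply/funext => x; rewrite mulN1r.
Qed.

Lemma L2Ml F H c : L2 F -> measurable_fun setT H -> (forall x, `|H x| <= c) ->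
  L2 (fun x => H x * F x).
Proof.
move=> [mF iF] mH Hc; split; first exact: measurable_funM.
apply: (L1_le _ (L1Zl (c ^+ 2) iF)).
  by apply: measurable_funX; exact: measurable_funM.
move=> x; have c0 : 0 <= c by exact: le_trans (normr_ge0 _) (Hc x).
rewrite normrX normrM exprMn (real_normK (num_real (F x))).
by rewrite ler_wpM2r ?sqr_ge0// lerXn2r ?nnegrE.
Qed.

Lemma L2_sum (I : Type) (s : seq I) (F : I -> T -> R) :
  (forall i, L2 (F i)) -> L2 (fun x => \sum_(i <- s) F i x).
Proof.
move=> iF; elim: s => [|i s IH].
  by under eq_fun do rewrite big_nil; exact: L2_cst.
by under eq_fun do rewrite big_cons; exact: L2D.
Qed.

Lemma norm2_ge0 F : 0 <= norm2 F. Proof. exact: sqrtr_ge0. Qed.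

Lemma sqr_norm2 F : norm2 F ^+ 2 = \int[P]_x (F x ^+ 2).
Proof. by rewrite sqr_sqrtr//; apply: Rexp_ge0 => x; exact: sqr_ge0. Qed.

Lemma Rexp_sqrD F H : L2 F -> L2 H ->
  \int[P]_x ((F x + H x) ^+ 2) =
  \int[P]_x (F x ^+ 2) + \int[P]_x (H x ^+ 2) + 2 * \int[P]_x (F x * H x).
Proof.
move=> LF LH; have [mF iF] := LF; have [mH iH] := LH.
have iFH := L2M LF LH; rewrite -RexpZl// -(RexpD iF iH) -RexpD.
- by apply: eq_Rintegral => x _; ring.
- exact: L1D iF iH.
- exact: L1Zl.
Qed.

Lemma Rexp_cauchy_schwarz F H : L2 F -> L2 H ->
  `|\int[P]_x (F x * H x)| <= norm2 F * norm2 H.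
Proof.
move=> LF LH; rewrite -sqrtr_sqr -sqrtrM; last first.
  by apply: Rexp_ge0 => x; exact: sqr_ge0.
apply: ler_wsqrtr; set a := \int[P]_x (F x ^+ 2); set c := \int[P]_x (H x ^+ 2).
set b := \int[P]_x (F x * H x).
have a0 : 0 <= a by apply: Rexp_ge0 => x; exact: sqr_ge0.
have c0 : 0 <= c by apply: Rexp_ge0 => x; exact: sqr_ge0.
have quad l : 0 <= a + l ^+ 2 * c + 2 * l * b.
  have : 0 <= \int[P]_x ((F x + l * H x) ^+ 2).
    by apply: Rexp_ge0 => x; exact: sqr_ge0.
  rewrite Rexp_sqrD//; last exact: L2Zl.
  suff [-> ->] : \int[P]_x ((l * H x) ^+ 2) = l ^+ 2 * c /\
      \int[P]_x (F x * (l * H x)) = l * b by rewrite mulrA.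
  split; last first.
    by rewrite -RexpZl; [apply: eq_Rintegral => x _; ring|exact: L2M].
  rewrite -RexpZl; last by case: LH.
  by apply: eq_Rintegral => x _; rewrite exprMn.
have [c00|cN0] := eqVneq c 0.
  (* For [c = 0] the quadratic is affine in [l]; if [b] were nonzero, this [l], equal to
     [-(a + 1) / b], would give the value [- a - 2 < 0]. *)
  rewrite c00 mulr0; have := quad (- (a + 1) * b / b ^+ 2).
  have [->|b0] := eqVneq b 0; first by rewrite expr0n.
  rewrite c00 mulr0 addr0 => h; exfalso.
  have : 2 * (- (a + 1) * b / b ^+ 2) * b = - (2 * (a + 1)) by field.
  by move=> e; rewrite e in h; nra.
(* The minimiser of the quadratic in [l]. *)
have := quad (- b / c).
have -> : a + (- b / c) ^+ 2 * c + 2 * (- b / c) * b = (a * c - b ^+ 2) / c.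
  by field.
by rewrite pmulr_lge0 ?subr_ge0// invr_gt0 lt0r cN0.
Qed.

Lemma norm2D F H : L2 F -> L2 H -> norm2 (fun x => F x + H x) <= norm2 F + norm2 H.
Proof.
move=> LF LH; rewrite -(ler_pXn2r (n := 2)) ?nnegrE ?norm2_ge0//; last first.
  by rewrite addr_ge0// norm2_ge0.
rewrite sqr_norm2 Rexp_sqrD// -!sqr_norm2.
have := ler_norm (\int[P]_x (F x * H x)).
have := Rexp_cauchy_schwarz LF LH.
lra.
Qed.

Lemma ler_norm_Rexp_norm2 F : L2 F -> `|\int[P]_x F x| <= norm2 F.
Proof.
move=> LF; have := Rexp_cauchy_schwarz (L2_cst 1) LF.
rewrite {1}/norm2 (_ : \int[P]_x (1 ^+ 2) = 1) ?sqrtr1 ?mul1r; last first.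
  by rewrite expr1n Rexp_cst.
by under eq_Rintegral do rewrite mul1r.
Qed.

Lemma norm2_center F : L2 F -> norm2 (fun x => F x - \int[P]_y F y) <= norm2 F.
Proof.
move=> LF; apply: ler_wsqrtr; set m := \int[P]_y F y.
rewrite (Rexp_sqrD LF (L2_cst (- m))).
rewrite Rexp_cst (_ : \int[P]_x (F x * - m) = - m * m); last first.
  by rewrite -RexpZl ?L2_L1//; apply: eq_Rintegral => x _; rewrite mulrC.
have := sqr_ge0 m; lra.
Qed.

End square_integrable.

(** * Independence and shift invariance for signed functions *)

Section independence.
Context d (G : measurableType d) (R : realType) (mu : probability G R).
Local Notation O := (Omega G).
Local Notation P := (path_measure mu).
Implicit Types U V F : O -> R.

(** Integrability of both factors suffices, without square integrability, since the absolute moments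
    factorize. *)
Lemma L1_indep n U V : L1 P U -> L1 P V -> depends n U ->
  L1 P (fun w => U w * V (shift n w)).
Proof.
move=> iU iV dU; have mU := L1_measurable iU; have mV := L1_measurable iV.
apply/integrableP; split.
  apply/measurable_EFinP; apply: measurable_funM => //.
  exact: (measurableT_comp mV (measurable_shift n)).
rewrite (_ : (\int[P]_w _)%E =
    (\int[P]_w (`|(U w)%:E| * `|(V (shift n w))%:E|))%E); last first.
  by apply: eq_integral => w _; rewrite /= normrM EFinM.
rewrite (ge0_integral_indep mu (U := fun w => `|(U w)%:E|%E)
  (V := fun w => `|(V w)%:E|%E))//.
- have /integrableP[_ fU] := iU; have /integrableP[_ fV] := iV.
  by apply: lte_mul_pinfty => //; [exact: integral_ge0|
    rewrite ge0_fin_numE//; exact: integral_ge0].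
- by apply: measurableT_comp => //; exact/measurable_EFinP.
- by apply: measurableT_comp => //; exact/measurable_EFinP.
- by move=> w w' ww'; rewrite (dU w w').
Qed.

Let ge0_Rexp_indep n U V : L1 P U -> L1 P V -> depends n U ->
  (forall w, 0 <= U w) -> (forall w, 0 <= V w) ->
  \int[P]_w (U w * V (shift n w)) = \int[P]_w U w * \int[P]_w V w.
Proof.
move=> iU iV dU U0 V0; apply: EFin_inj.
rewrite EFinM -!integral_RexpE//; last exact: L1_indep.
rewrite -(ge0_integral_indep mu (n := n) (U := fun w => (U w)%:E)
  (V := fun w => (V w)%:E))//.
- exact: measurable_int iU.
- exact: measurable_int iV.
- by move=> w w' ww'; rewrite (dU w w').
Qed.

Lemma Rexp_indep n U V : L1 P U -> L1 P V -> depends n U ->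
  \int[P]_w (U w * V (shift n w)) = \int[P]_w U w * \int[P]_w V w.
Proof.
have pos F w : 0 <= `|F w| + F w by rewrite -lerBlDr sub0r -normrN ler_norm.
(* a function is the difference of the nonnegative functions |F| + F and |F| *)
have step U' V' : L1 P U' -> L1 P V' -> depends n U' -> (forall w, 0 <= U' w) ->
    \int[P]_w (U' w * V' (shift n w)) = \int[P]_w U' w * \int[P]_w V' w.
  move=> iU iV dU U0; have iaV := L1_norm iV; have iAV := L1D iaV iV.
  transitivity (\int[P]_w (U' w * (`|V' (shift n w)| + V' (shift n w)) -
                           U' w * `|V' (shift n w)|)).
    by apply: eq_Rintegral => w _; rewrite mulrDr addrC addKr.
  rewrite RexpB; last 2 first.
  - exact: (L1_indep iU iAV dU).
  - exact: (L1_indep iU iaV dU).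
  rewrite (ge0_Rexp_indep iU iAV dU U0 (pos V')).
  rewrite (ge0_Rexp_indep iU iaV dU U0 (fun w => normr_ge0 (V' w))).
  by rewrite RexpD// mulrDr addrC addKr.
move=> iU iV dU; have iaU := L1_norm iU; have iAU := L1D iaU iU.
have daU : depends n (fun w => `|U w|) by move=> w w' ww'; rewrite (dU w w').
have dAU : depends n (fun w => `|U w| + U w).
  by move=> w w' ww'; rewrite (dU w w').
transitivity (\int[P]_w ((`|U w| + U w) * V (shift n w) -
                         `|U w| * V (shift n w))).
  by apply: eq_Rintegral => w _; rewrite mulrDl addrC addKr.
rewrite RexpB; last 2 first.
- exact: (L1_indep iAU iV dAU).
- exact: (L1_indep iaU iV daU).
rewrite (step _ _ iAU iV dAU (pos U)) (step _ _ iaU iV daU)//.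
by rewrite RexpD// mulrDl addrC addKr.
Qed.

(** Independence with [U = 1] is the invariance of the product measure under the shift. *)
Lemma L1_shift n V : L1 P V -> L1 P (fun w => V (shift n w)).
Proof.
move=> iV; have d1 : depends n (fun _ : O => 1 : R) by [].
have := L1_indep (L1_cst P 1) iV d1; congr (L1 _ _).
by apply/funext => w; rewrite mul1r.
Qed.

Lemma Rexp_shift n V : L1 P V -> \int[P]_w V (shift n w) = \int[P]_w V w.
Proof.
move=> iV; have d1 : depends n (fun _ : O => 1 : R) by [].
have := Rexp_indep (L1_cst P 1) iV d1.
by rewrite Rexp_cst mul1r => <-; apply: eq_Rintegral => w _; rewrite mul1r.
Qed.

Lemma L2_shift n V : L2 P V -> L2 P (fun w => V (shift n w)).
Proof.
move=> [mV iV]; split; last exact: (L1_shift n iV).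
exact: (measurableT_comp mV (measurable_shift n)).
Qed.

End independence.

(** * Change of law on finitely many coordinates *)

Section change_of_measure.
Context d (G : measurableType d) (R : realType) (mu' mu : probability G R).
Local Notation O := (Omega G).
Variable f : G -> R.
Hypotheses (ac : mu' `<< mu) (fd : is_density mu' mu f).

Definition path_density n (w : O) : R := \prod_(i < n) f (w i).

Lemma path_density_ge0 n w : 0 <= path_density n w.
Proof. by rewrite prodr_ge0// => i _; case: fd. Qed.

Lemma measurable_path_density n : measurable_fun setT (path_density n).
Proof.
apply: measurable_prod => i _; have [mf _ _] := fd.
by apply: (measurableT_comp mf); exact: measurable_coord.
Qed.

Let aux n (F : O -> R) : measurable_fun setT F -> depends n F ->
  (forall w, 0 <= F w) ->
  (\int[path_measure mu']_w (F w)%:E =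
   \int[path_measure mu]_w (F w * path_density n w)%:E)%E.
Proof.
move=> mF dF F0; rewrite (ge0_integral_path_density ac fd (n := n))//.
- exact/measurable_EFinP.
- by move=> w w' ww'; rewrite (dF w w').
Qed.

Lemma L1_path_density n (F : O -> R) :
  measurable_fun setT F -> depends n F ->
  L1 (path_measure mu) (fun w => F w * path_density n w) ->
  L1 (path_measure mu') F.
Proof.
move=> mF dF /integrableP[_ iF]; apply/integrableP; split.
  exact/measurable_EFinP.
apply: le_lt_trans iF; rewrite [leLHS](aux (n := n) (F := fun w => `|F w|))//.
- apply: ge0_le_integral => //.
  + by move=> w _; rewrite lee_fin mulr_ge0// path_density_ge0.
  + apply/measurable_EFinP; apply: measurable_funM.
      exact: measurableT_comp.
    exact: measurable_path_density.
  + apply: measurableT_comp => //; apply/measurable_EFinP.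
    by apply: measurable_funM => //; exact: measurable_path_density.
  + move=> w _; rewrite /= lee_fin normrM ler_wpM2l//.
    exact: ler_norm.
- exact: measurableT_comp.
- by move=> w w' ww'; rewrite (dF w w').
Qed.

Lemma Rexp_path_density n (F : O -> R) :
  measurable_fun setT F -> depends n F ->
  L1 (path_measure mu) (fun w => F w * path_density n w) ->
  \int[path_measure mu']_w F w =
  \int[path_measure mu]_w (F w * path_density n w).
Proof.
move=> mF dF iF; have iF' := L1_path_density mF dF iF.
have iaF : L1 (path_measure mu) (fun w => `|F w| * path_density n w).
  have := L1_norm iF; congr (L1 _ _); apply/funext => w.
  by rewrite normrM [X in _ * X = _]ger0_norm// path_density_ge0.
have iAF : L1 (path_measure mu) (fun w => (`|F w| + F w) * path_density n w).
  have := L1D iaF iF; congr (L1 _ _); apply/funext => w.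
  by rewrite mulrDl.
transitivity (\int[path_measure mu']_w ((`|F w| + F w) - `|F w|)).
  by apply: eq_Rintegral => w _; rewrite addrC addKr.
have iaF' := L1_norm iF'.
rewrite RexpB//; last exact: L1D.
transitivity (\int[path_measure mu]_w
  ((`|F w| + F w) * path_density n w - `|F w| * path_density n w)); last first.
  by apply: eq_Rintegral => w _; rewrite mulrDl addrC addKr.
have auxR (F' : O -> R) : measurable_fun setT F' -> depends n F' ->
    (forall w, 0 <= F' w) ->
    \int[path_measure mu']_w F' w =
    \int[path_measure mu]_w (F' w * path_density n w).
  by move=> mF' dF' F'0; rewrite /Rintegral (aux mF' dF' F'0).
rewrite (RexpB iAF iaF).
rewrite -(auxR (fun w => `|F w| + F w)) -?(auxR (fun w => `|F w|))//.
- exact: measurableT_comp.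
- by move=> w w' ww'; rewrite (dF w w').
- by apply: measurable_funD => //; exact: measurableT_comp.
- by move=> w w' ww'; rewrite (dF w w').
- by move=> w; rewrite -lerBlDr sub0r -normrN ler_norm.
Qed.

Lemma Rexp_density1 (M : R) : (forall a, f a <= M) ->
  \int[path_measure mu]_w f (w 0%N) = 1.
Proof.
move=> fM; have [mf f0 _] := fd.
have := @Rexp_path_density 1 (fun=> 1) (measurable_cst _) (fun _ _ _ => erefl).
rewrite Rexp_cst => ->.
  by apply: eq_Rintegral => w _; rewrite mul1r /path_density big_ord1.
apply: (@L1_bounded _ _ _ _ _ M).
  by apply: measurable_funM => //; exact: measurable_path_density.
by move=> w; rewrite mul1r /path_density big_ord1 ger0_norm.
Qed.

End change_of_measure.

(** * Growth and convergence of almost additive sequences *)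

Section almost_additive_sequences.
Variable R : realType.
Implicit Types (u e : nat -> R) (A C : R).

(** For [a <= b <= 2 a] the cross term in the square of [sqrt a + sqrt b] is at least [2 a], so
    splitting gains a factor bounded away from 1; [5 / 4] is a convenient such factor, and this gain
    pays for the error of each split below. *)
Lemma halving k : (1 < k)%N -> exists a b, [/\ (k = a + b)%N, (0 < a < k)%N,
  (0 < b < k)%N & 5 / 4 * Num.sqrt k%:R <= Num.sqrt a%:R + Num.sqrt b%:R :> R].
Proof.
move=> k1; exists k./2, (k - k./2)%N; have := odd_double_half k => kE.
split; [lia|lia|lia|].
set a := k./2; set b := (k - a)%N.
have ka : k%:R = a%:R + b%:R :> R by rewrite -natrD; congr _%:R; lia.
have ab : a%:R <= b%:R :> R by rewrite ler_nat; lia.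
have ba : b%:R <= 2 * a%:R :> R by rewrite -natrM ler_nat; lia.
rewrite ka in ab ba *; have a0 : 0 <= a%:R :> R by [].
set x := Num.sqrt a%:R; set y := Num.sqrt b%:R; set z := Num.sqrt _.
have x0 : 0 <= x by exact: sqrtr_ge0.
have y0 : 0 <= y by exact: sqrtr_ge0.
have z0 : 0 <= z by exact: sqrtr_ge0.
have xE : x ^+ 2 = a%:R by rewrite sqr_sqrtr.
have yE : y ^+ 2 = b%:R by rewrite sqr_sqrtr.
have zE : z ^+ 2 = a%:R + b%:R by rewrite sqr_sqrtr// addr_ge0.
have xy : x <= y by exact: ler_wsqrtr.
have xy2 : x ^+ 2 <= x * y by rewrite expr2 ler_wpM2l.
rewrite -(ler_pXn2r (n := 2)) ?nnegrE ?mulr_ge0 ?addr_ge0//.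
rewrite exprMn zE -xE -yE sqrrD; rewrite -xE -yE in ba; nra.
Qed.

Lemma natr_sqrt_ge1 k : (0 < k)%N -> 1 <= Num.sqrt k%:R :> R.
Proof. by move=> k0; rewrite -[leLHS]sqrtr1 ler_wsqrtr// ler1n. Qed.

(** The bound is strengthened to [A * sqrt k - B] so that the induction closes. When [k] is halved,
    the cross terms give [- 5/2 A B sqrt k], while only [- 9/4 A B sqrt k] is needed to absorb [C];
    the surplus covers the terms in [B ^+ 2]. *)
Lemma quadratic_growth u C : 0 <= C -> (forall n, 0 <= u n) ->
  (forall n m, u (n + m)%N <= Num.sqrt (u n ^+ 2 + u m ^+ 2) + C) ->
  exists2 A, 0 <= A & forall n, (0 < n)%N -> u n <= A * Num.sqrt n%:R.
Proof.
(* [B = 8 C] makes [2 (B + C)] equal to [9/4 B], below the [5/2 B] gained; [8 B <= A] makes the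
   surplus at least [2 B ^+ 2]; the summand [u 1 + B] serves the case [k = 1]. *)
move=> C0 u0 uD; pose B := 8 * C; pose A := 8 * B + (u 1%N + B).
have B0 : 0 <= B by rewrite mulr_ge0.
have A0 : 0 <= A by rewrite !addr_ge0// mulr_ge0.
have A8 : 8 * B <= A by rewrite lerDl addr_ge0.
suff uA k : (0 < k)%N -> u k <= A * Num.sqrt k%:R - B.
  by exists A => // n /uA/le_trans; apply; rewrite gerBl.
elim/ltn_ind: k => k IH k0; have [k1|k1] := leqP k 1.
  have -> : k = 1%N by lia.
  by rewrite sqrtr1 mulr1 /A addrA addrK lerDr mulr_ge0.
have [a [b [kE /andP[a0 ak] /andP[b0 bk]]]] := halving k1.
have := IH _ ak a0; have := IH _ bk b0; have := natr_sqrt_ge1 k0.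
have := uD a b; have := u0 a; have := u0 b; rewrite -kE.
have : Num.sqrt k%:R ^+ 2 = Num.sqrt a%:R ^+ 2 + Num.sqrt b%:R ^+ 2 :> R.
  by rewrite !sqr_sqrtr// kE natrD.
move: (Num.sqrt k%:R) (Num.sqrt a%:R) (Num.sqrt b%:R) => z x y zE ub ua uk z1.
move=> uby uax xyz; apply: (le_trans uk); rewrite -lerBrDr.
have AB : B * 8 * B <= B * A * z.
  apply: (@le_trans _ _ (B * A)); first by rewrite -mulrA ler_wpM2l.
  by rewrite ler_peMr// mulr_ge0.
have ABxy : A * B * (5 / 4 * z) <= A * B * (x + y) by rewrite ler_wpM2l ?mulr_ge0.
have Az : A <= A * z by rewrite ler_peMr.
have CB : C = B / 8 by rewrite /B; field.
rewrite -[leRHS]ger0_norm; last by lra.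
rewrite -sqrtr_sqr ler_wsqrtr//.
have : u a ^+ 2 <= (A * x - B) ^+ 2 by rewrite lerXn2r ?nnegrE// (le_trans ua).
have : u b ^+ 2 <= (A * y - B) ^+ 2 by rewrite lerXn2r ?nnegrE// (le_trans ub).
have -> : (A * z - B - C) ^+ 2 =
    A ^+ 2 * z ^+ 2 - 2 * A * z * (B + C) + (B + C) ^+ 2 by ring.
rewrite zE CB => h1 h2; apply: (le_trans (lerD h2 h1)).
have : 0 <= B ^+ 2 by exact: sqr_ge0.
have -> : (A * x - B) ^+ 2 + (A * y - B) ^+ 2 = A ^+ 2 * (x ^+ 2 + y ^+ 2) -
  2 * (A * B * (x + y)) + 2 * B ^+ 2 by ring.
have -> : A ^+ 2 * (x ^+ 2 + y ^+ 2) - 2 * A * z * (B + B / 8) +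
   (B + B / 8) ^+ 2 = A ^+ 2 * (x ^+ 2 + y ^+ 2) - 9 / 4 * (B * A * z) +
   (81 / 64) * B ^+ 2 by field.
have e1 : B * 8 * B = 8 * B ^+ 2 by ring.
have e2 : A * B * (5 / 4 * z) = 5 / 4 * (B * A * z) by ring.
rewrite e1 in AB; rewrite e2 in ABxy; lra.
Qed.

(** Balanced splitting of [k] keeps the total error linear in [k], whereas adding one copy at a time
    would sum to order [k ^ (3/2)]. In the sharper bound with [k - sqrt k], one split costs
    [C * sqrt n * sqrt k], exactly what [4 * (sqrt a + sqrt b - sqrt k) >= sqrt k] returns. *)
Lemma sqrt_additive_multiple u C : 0 <= C ->
  (forall n m, `|u (n + m)%N - u n - u m| <= C * Num.sqrt (n + m)%:R) ->
  forall n k, (0 < k)%N ->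
  `|u (k * n)%N - k%:R * u n| <= 4 * C * k%:R * Num.sqrt n%:R.
Proof.
move=> C0 uD n k k0; set s := Num.sqrt n%:R; have s0 : 0 <= s by exact: sqrtr_ge0.
suff uA : `|u (k * n)%N - k%:R * u n| <= 4 * C * s * (k%:R - Num.sqrt k%:R).
  apply: (le_trans uA); rewrite -[leRHS]mulrAC -mulrA [in leRHS]mulrC.
  by rewrite [leRHS]mulrC mulrA ler_wpM2l ?mulr_ge0// gerBl sqrtr_ge0.
elim/ltn_ind: k k0 => k IH k0; have [k1|k1] := leqP k 1.
  have -> : k = 1%N by lia.
  by rewrite mul1n mul1r subrr normr0 sqrtr1 subrr mulr0.
have [a [b [kE /andP[a0 ak] /andP[b0 bk]]]] := halving k1.
have := IH _ ak a0; have := IH _ bk b0.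
have := uD (a * n)%N (b * n)%N.
rewrite -mulnDl -kE natrM sqrtrM// -/s.
have kR : k%:R = a%:R + b%:R :> R by rewrite kE natrD.
move: (Num.sqrt k%:R) (Num.sqrt a%:R) (Num.sqrt b%:R) => z x y.
rewrite kR => h1 h2 h3 h4.
have : C * s * (5 / 4 * z) <= C * s * (x + y) by rewrite ler_wpM2l ?mulr_ge0.
rewrite !ler_norml in h1 h2 h3 *.
case/andP: h1 => h1 h1'; case/andP: h2 => h2 h2'; case/andP: h3 => h3 h3'.
move=> h5; apply/andP; split; lra.
Qed.

Lemma additive_multiple u C :
  (forall n m, `|u (n + m)%N - u n - u m| <= C) ->
  forall n k, (0 < k)%N -> `|u (k * n)%N - k%:R * u n| <= C * k%:R.
Proof.
move=> uD n; have C0 : 0 <= C := le_trans (normr_ge0 _) (uD 0%N 0%N).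
elim=> // -[|k] IH _; first by rewrite mul1n mul1r subrr normr0 mulr1.
have := IH isT; have := uD n (k.+1 * n)%N; rewrite -mulSn.
rewrite !ler_norml -[in k.+2%:R]natr1 => /andP[h1 h1'] /andP[h2 h2'].
apply/andP; split; lra.
Qed.

(** Both [u n / n] and [u m / m] are compared with the value at the common multiple [m * n], so they
    differ by at most [e n + e m]: the sequence is Cauchy, and letting [m] tend to infinity gives
    the rate. *)
Lemma cvg_of_multiples u e : (forall n, 0 <= e n) -> e @ \oo --> 0 ->
  (forall n k, (0 < k)%N -> (0 < n)%N ->
     `|u (k * n)%N - k%:R * u n| <= k%:R * (n%:R * e n)) ->
  cvg (n%:R^-1 * u n @[n --> \oo]) /\
  forall n, (0 < n)%N ->
    `|n%:R^-1 * u n - lim (n%:R^-1 * u n @[n --> \oo])| <= e n.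
Proof.
move=> e0 ecvg uM; pose v n := n%:R^-1 * u n.
have vM n k : (0 < k)%N -> (0 < n)%N -> `|v (k * n)%N - v n| <= e n.
  move=> k0 n0; have kn0 : 0 < (k * n)%:R :> R by rewrite ltr0n muln_gt0 k0.
  have kR : 0 < k%:R :> R by rewrite ltr0n.
  have nR : 0 < n%:R :> R by rewrite ltr0n.
  rewrite -(ler_pM2l kn0) -[X in X * `|_|](ger0_norm (ltW kn0)) -normrM.
  have -> : (k * n)%:R * (v (k * n)%N - v n) = u (k * n)%N - k%:R * u n.
    by rewrite /v natrM; field; rewrite !gt_eqF.
  by rewrite natrM -mulrA; exact: uM.
have vv n m : (0 < n)%N -> (0 < m)%N -> `|v n - v m| <= e n + e m.
  move=> n0 m0; have := vM n m m0 n0; have := vM m n n0 m0.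
  rewrite (mulnC n m) => h1 h2.
  by rewrite (le_trans (ler_distD (v (m * n)%N) _ _))// lerD// distrC.
have vcvg : cvg (v @ \oo).
  apply/cauchy_cvgP/cauchy_exP => eps eps0.
  have e20 : 0 < eps / 2 by rewrite divr_gt0.
  move/cvgrPdist_lt : ecvg => /(_ _ e20) [N _ Ne].
  exists (v N.+1), N.+1 => // n /= nN.
  have := vv N.+1 n isT (leq_ltn_trans (leq0n _) nN).
  move/le_lt_trans; apply; rewrite [ltRHS]splitr ltrD//.
    by have := Ne N.+1 (leqnSn N); rewrite /= sub0r normrN ger0_norm.
  by have := Ne n (ltnW nN); rewrite /= sub0r normrN ger0_norm.
split => // n n0.
have h : `|v n - v m| @[m --> \oo] --> `|v n - lim (v @ \oo)|.
  by apply: cvg_norm; apply: cvgB; [exact: cvg_cst|exact: vcvg].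
have h' : e n + e m @[m --> \oo] --> e n + 0.
  by apply: cvgD; [exact: cvg_cst|].
rewrite -(cvg_lim _ h)// -[leRHS]addr0 -(cvg_lim _ h')//.
apply: ler_lim; [by apply/cvg_ex; eexists; exact: h|
  by apply/cvg_ex; eexists; exact: h'|].
by exists 1%N => // m /= m0; exact: vv.
Qed.

Lemma cvg_almost_additive u C :
  (forall n m, `|u (n + m)%N - u n - u m| <= C) ->
  cvg (n%:R^-1 * u n @[n --> \oo]) /\
  forall n, (0 < n)%N ->
    `|n%:R^-1 * u n - lim (n%:R^-1 * u n @[n --> \oo])| <= C * n%:R^-1.
Proof.
move=> uD; have C0 : 0 <= C := le_trans (normr_ge0 _) (uD 0%N 0%N).
apply: cvg_of_multiples => [n||n k k0 n0]; first by rewrite mulr_ge0.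
- rewrite -[X in _ --> X](mulr0 C); apply: cvgM; first exact: cvg_cst.
  by apply/gtr0_cvgV0; [exists 1%N => // n /=; rewrite ltr0n|exact: cvgr_idn].
- apply: (le_trans (additive_multiple uD n k0)); rewrite mulrC ler_wpM2l//.
  by rewrite mulrCA divff ?mulr1// pnatr_eq0 -lt0n.
Qed.

Lemma cvg_sqrt_additive u C : 0 <= C ->
  (forall n m, `|u (n + m)%N - u n - u m| <= C * Num.sqrt (n + m)%:R) ->
  cvg (n%:R^-1 * u n @[n --> \oo]).
Proof.
move=> C0 uD; pose e n := 4 * C * (Num.sqrt n%:R)^-1 : R.
apply: (@cvg_of_multiples u e _ _ _).1 => [n||n k k0 n0].
- by rewrite !mulr_ge0// invr_ge0 sqrtr_ge0.
- rewrite -[X in _ --> X](mulr0 (4 * C)); apply: cvgM; first exact: cvg_cst.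
  apply/gtr0_cvgV0; first by exists 1%N => // n /= n0; rewrite sqrtr_gt0 ltr0n.
  apply/cvgryPge => A; exists (Num.truncn (A ^+ 2)).+1 => // n /= nA.
  rewrite (le_trans (ler_norm A))// -sqrtr_sqr ler_wsqrtr//.
  apply: (le_trans (ltW (truncnS_gt _))); first by rewrite ler_nat.
- apply: (le_trans (sqrt_additive_multiple C0 uD n k0)).
  have s0 : 0 < Num.sqrt n%:R :> R by rewrite sqrtr_gt0 ltr0n.
  rewrite /e -{2}(@sqr_sqrtr _ n%:R)// le_eqVlt; apply/orP; left; apply/eqP.
  by field; rewrite gt_eqF.
Qed.

End almost_additive_sequences.

(** * Sums of a centred function of the increments *)

Section coordinate_sums.
Context d (G : measurableType d) (R : realType) (mu : probability G R).
Local Notation O := (Omega G).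
Local Notation P := (path_measure mu).
Variable h : G -> R.

(** As [w i] is the coordinate of index [i + 1], this is h(X_1) + ... + h(X_n). It serves for [nu],
    for [f - 1], and for the difference between [nu] and the quotient of [f - 1] by [t]. *)
Definition coord_sum n (w : O) : R := \sum_(i < n) h (w i).

Lemma coord_sumD n m w :
  coord_sum (n + m) w = coord_sum n w + coord_sum m (shift n w).
Proof. by rewrite /coord_sum big_split_ord. Qed.

Lemma depends_coord_sum n : depends n (coord_sum n).
Proof. by move=> w w' ww'; apply: eq_bigr => i _; rewrite ww'. Qed.

Hypothesis L2h : L2 P (fun w : O => h (w 0%N)).

Lemma L2_coord i : L2 P (fun w : O => h (w i)).
Proof.
have := L2_shift i L2h; congr (L2 _ _); apply/funext => w.
by rewrite /shift addn0.
Qed.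

Lemma L2_coord_sum n : L2 P (coord_sum n).
Proof. by apply: L2_sum => i; exact: L2_coord. Qed.

Hypothesis h0 : \int[P]_w h (w 0%N) = 0.

Lemma Rexp_coord_sum n : \int[P]_w coord_sum n w = 0.
Proof.
rewrite Rexp_sum => [|i]; last exact/L2_L1/L2_coord.
rewrite big1// => i _; rewrite -h0 -(Rexp_shift i (L2_L1 L2h)).
by apply: eq_Rintegral => w _; rewrite /shift addn0.
Qed.

(** Each new term is independent of the preceding sum, which has mean 0, so the squares add. *)
Lemma norm2_coord_sum n :
  norm2 P (coord_sum n) = Num.sqrt n%:R * norm2 P (fun w => h (w 0%N)).
Proof.
rewrite [norm2 _ (fun w => _)]/norm2 -sqrtrM//; congr Num.sqrt.
elim: n => [|n IH].
  rewrite mul0r -[RHS](Rexp_cst P); apply: eq_Rintegral => w _.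
  by rewrite /coord_sum big_ord0 expr0n.
pose V (w : O) := h (w 0%N).
have Vn w : V (shift n w) = h (w n) by rewrite /V /shift addn0.
transitivity (\int[P]_w ((coord_sum n w + V (shift n w)) ^+ 2)).
  by apply: eq_Rintegral => w _; rewrite /coord_sum big_ord_recr /= Vn.
rewrite Rexp_sqrD; last 2 first.
- exact: L2_coord_sum.
- exact: (L2_shift n L2h).
rewrite IH (Rexp_indep (L2_L1 (L2_coord_sum n)) (L2_L1 L2h)); last first.
  exact: depends_coord_sum.
rewrite Rexp_coord_sum mul0r mulr0 addr0 -natr1 mulrDl mul1r; congr (_ + _).
by case: L2h => _ i2; exact: (Rexp_shift n i2).
Qed.

End coordinate_sums.

(** * Rate of escape, variance and score covariation of a cocycle *)

Section cocycle_estimates.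
Context d (G : measurableType d) (R : realType) (Q : nat -> Omega G -> R).
Local Notation O := (Omega G).
Hypothesis Q_cocycle : defective_adapted_cocycle Q.

Lemma cocycle_adapted n : measurable_fun setT (Q n) /\ depends n (Q n).
Proof.
have [Q0 mQ] := Q_cocycle; case: n => [|n]; last first.
  by apply: past_measurable_fun; exact: mQ.
by rewrite (_ : Q 0%N = fun=> 0); [split|apply/funext].
Qed.

Let mQ n := (cocycle_adapted n).1.
Let dQ n := (cocycle_adapted n).2.

Lemma measurable_defect n m : measurable_fun setT (defect Q n m).
Proof.
by apply: measurable_funB; [exact: measurable_funB|
  exact: (measurableT_comp (mQ m) (measurable_shift n))].
Qed.

Lemma cocycleD n m (w : O) :
  Q (n + m)%N w = Q n w + Q m (shift n w) + defect Q n m w.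
Proof. by rewrite /defect; ring. Qed.

(** By shift invariance the means of [Q n] are additive up to the mean of a defect. The rate
    involves the law only through [C], which yields uniformity along the curve. *)
Lemma rate_of_escape_cvg (mu : probability G R) (C : R) :
  (forall n, L1 (path_measure mu) (Q n)) ->
  (forall n m, \int[path_measure mu]_w `|defect Q n m w| <= C) ->
  forall n, (0 < n)%N ->
  `|n%:R^-1 * \int[path_measure mu]_w Q n w - rate_of_escape mu Q| <= C * n%:R^-1.
Proof.
move=> iQ QC n n0.
have -> : rate_of_escape mu Q =
    lim (n%:R^-1 * \int[path_measure mu]_w Q n w @[n --> \oo]).
  by rewrite /rate_of_escape unlock.
apply: (cvg_almost_additive _).2 n0 => {}n m; apply: le_trans (QC n m).
have iQs := L1_shift n (iQ m).
have iD : L1 (path_measure mu) (defect Q n m) by exact: L1B (L1B _ _) _.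
by rewrite -(Rexp_shift n (iQ m)) -RexpB// -RexpB ?ler_norm_Rexp//; exact: L1B.
Qed.

Section square_integrable_cocycle.
Variables (mu : probability G R) (tau : R).
Local Notation P := (path_measure mu).
Hypotheses (L2Q1 : L2 P (Q 1)) (L2defect : forall n m, L2 P (defect Q n m)).
Hypothesis tauD : forall n m, norm2 P (defect Q n m) <= tau.

Let tau0 : 0 <= tau. Proof. exact: le_trans (norm2_ge0 _ _) (tauD 0 0). Qed.

Lemma L2_cocycle n : L2 P (Q n).
Proof.
elim: n => [|n IH].
  rewrite (_ : Q 0%N = fun=> 0); first exact: L2_cst.
  by apply/funext; case: Q_cocycle.
rewrite (_ : Q n.+1 = fun w => Q n w + Q 1%N (shift n w) + defect Q n 1 w).
  by apply: L2D (L2defect n 1%N); apply: L2D => //; exact: L2_shift.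
by apply/funext => w; rewrite -cocycleD addn1.
Qed.

Definition centered n (w : O) : R := Q n w - \int[P]_v Q n v.

Lemma L2_centered n : L2 P (centered n).
Proof. by apply: L2B; [exact: L2_cocycle|exact: L2_cst]. Qed.

Lemma Rexp_centered n : \int[P]_w centered n w = 0.
Proof.
rewrite RexpB ?Rexp_cst ?subrr//; first exact/L2_L1/L2_cocycle.
exact: L1_cst.
Qed.

(** The centred [Q n] and the shifted centred [Q m] are orthogonal, so their norms combine by
    Pythagoras; the centred defect adds at most [tau]. This is the recursion of
    [quadratic_growth]. *)
Lemma norm2_centered : exists2 A, 0 <= A &
  forall n, (0 < n)%N -> norm2 P (centered n) <= A * Num.sqrt n%:R.
Proof.
apply: (@quadratic_growth _ _ tau) => // [n|n m]; first exact: norm2_ge0.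
have Lc := L2_centered; have Ls := L2_shift n (Lc m).
pose D w := defect Q n m w - \int[P]_v defect Q n m v.
have LD : L2 P D by apply: L2B => //; exact: L2_cst.
have iQ k := L2_L1 (L2_cocycle k); have iQs := L1_shift n (iQ m).
have -> : centered (n + m) = fun w => centered n w + centered m (shift n w) + D w.
  apply/funext => w; rewrite /centered /D.
  rewrite [in RHS]/defect RexpB//; last exact: L1B.
  by rewrite RexpB// (Rexp_shift n (iQ m)); ring.
apply: (le_trans (norm2D (L2D _ _) LD)) => //.
apply: lerD; last first.
  apply: le_trans (norm2_center _) (tauD n m); exact: L2defect.
rewrite [leLHS]/norm2 Rexp_sqrD// (Rexp_indep (L2_L1 (Lc n)) (L2_L1 (Lc m))).
  rewrite Rexp_centered mul0r mulr0 addr0 !sqr_norm2.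
  by have [_ i2] := Lc m; rewrite (Rexp_shift n i2).
by move=> w w' ww'; rewrite /centered (dQ ww').
Qed.

Variable nu : G -> R.
Hypotheses (mnu : measurable_fun setT nu) (M : R) (nuM : forall a, `|nu a| <= M).
Hypothesis nu0 : \int[P]_w nu (w 0%N) = 0.

Lemma L2_nu : L2 P (fun w : O => nu (w 0%N)).
Proof.
apply: (@L2_bounded _ _ _ _ _ M) => //.
by apply: (measurableT_comp mnu); exact: measurable_coord.
Qed.

Lemma score_covariationE n : score_covariation nu mu Q n =
  n%:R^-1 * \int[P]_w (Q n w * coord_sum nu n w).
Proof.
rewrite /score_covariation unlock; congr (_ * fine _).
by apply: eq_integral => w _; rewrite big_add1 big_mkord.
Qed.

(** In the expansion over blocks of lengths [n] and [m], the mixed products vanish by independence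
    and [nu0]. What remains is the defect against the full sum, bounded by Cauchy-Schwarz by a
    multiple of [sqrt (n + m)]. *)
Lemma score_covariation_cvg : cvg (score_covariation nu mu Q n @[n --> \oo]).
Proof.
under eq_fun do rewrite score_covariationE.
apply: (@cvg_sqrt_additive _ _ (tau * norm2 P (fun w => nu (w 0%N)))).
  by rewrite mulr_ge0// norm2_ge0.
move=> n m; have LS k := L2_coord_sum L2_nu k; have LQ := L2_cocycle.
have iQS k := L2M (LQ k) (LS k).
have iQm := L1_shift n (iQS m).
have iQ k := L2_L1 (LQ k); have iS k := L2_L1 (LS k).
have dS := @depends_coord_sum _ G R nu n.
have x1 := L1_indep (iQ n) (iS m) (@dQ n); have x2 := L1_indep (iS n) (iQ m) dS.
have xD := L2M (L2defect n m) (LS (n + m)%N).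
have -> : \int[P]_w (Q (n + m)%N w * coord_sum nu (n + m) w) =
  \int[P]_w (Q n w * coord_sum nu n w +
    Q m (shift n w) * coord_sum nu m (shift n w) +
    Q n w * coord_sum nu m (shift n w) + coord_sum nu n w * Q m (shift n w) +
    defect Q n m w * coord_sum nu (n + m) w).
  by apply: eq_Rintegral => w _; rewrite cocycleD coord_sumD; ring.
have i1 := L1D (iQS n) iQm; have i2 := L1D i1 x1; have i3 := L1D i2 x2.
rewrite (RexpD i3 xD) (RexpD i2 x2) (RexpD i1 x1) (RexpD (iQS n) iQm).
rewrite (Rexp_shift n (iQS m)).
rewrite (Rexp_indep (iQ n) (iS m) (@dQ n)) (Rexp_indep (iS n) (iQ m) dS).
rewrite !(Rexp_coord_sum L2_nu nu0) mulr0 mul0r !addr0.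
rewrite [X in `|X|](_ : _ = \int[P]_w (defect Q n m w * coord_sum nu (n + m) w));
  last by ring.
apply: (le_trans (Rexp_cauchy_schwarz (L2defect n m) (LS _))).
rewrite (norm2_coord_sum L2_nu nu0) mulrCA [leRHS]mulrC ler_wpM2l ?sqrtr_ge0//.
by rewrite ler_wpM2r ?norm2_ge0.
Qed.

End square_integrable_cocycle.

End cocycle_estimates.

(** * First-order expansion of the path density *)

Section density_expansion.
Context d (G : measurableType d) (R : realType) (mu' mu : probability G R).
Local Notation O := (Omega G).
Local Notation P := (path_measure mu).
Variables (f : G -> R) (r : R).
Hypotheses (ac : mu' `<< mu) (fd : is_density mu' mu f).
Hypothesis fr : forall a, `|f a - 1| <= r.

Local Notation g a := (f a - 1).
Local Notation M := (path_density f).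
(** The variance under [mu] of the one-step density; along the curve it is at most of order
    [t ^+ 2]. *)
Local Notation s := (\int[P]_w ((f (w 0%N) - 1) ^+ 2)).

Let fB a : f a <= 1 + r.
Proof. by rewrite addrC -lerBlDr (le_trans (ler_norm _)). Qed.

Let mf : measurable_fun setT f. Proof. by case: fd. Qed.

Let mg : measurable_fun setT (fun w : O => g (w 0%N)).
Proof.
apply: measurable_funB => //.
by apply: (measurableT_comp mf); exact: measurable_coord.
Qed.

Lemma L2_density_sub1 : L2 P (fun w : O => g (w 0%N)).
Proof. by apply: (@L2_bounded _ _ _ _ _ r mg) => w; exact: fr. Qed.

Lemma Rexp_density_sub1 : \int[P]_w g (w 0%N) = 0.
Proof.
rewrite RexpB ?Rexp_cst ?(Rexp_density1 ac fd fB) ?subrr//; last exact: L1_cst.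
apply: (@L1_bounded _ _ _ _ _ (1 + r)).
  by apply: (measurableT_comp mf); exact: measurable_coord.
by move=> w; rewrite ger0_norm//; case: fd.
Qed.

Lemma path_density_bound n (w : O) : `|M n w| <= (1 + r) ^+ n.
Proof.
rewrite ger0_norm ?(path_density_ge0 fd)//.
rewrite -[X in _ ^+ X]card_ord -prodr_const; apply: ler_prod => i _.
by rewrite fB andbT; case: fd.
Qed.

Lemma L2_path_density n : L2 P (M n).
Proof.
by apply: (@L2_bounded _ _ _ _ _ ((1 + r) ^+ n)) => [|w];
  [exact: measurable_path_density fd n|exact: path_density_bound].
Qed.

Lemma Rexp_path_density1 n : \int[P]_w M n w = 1.
Proof.
have iM : L1 P (fun w => 1 * M n w).
  have := L2_L1 (L2_path_density n); congr (L1 _ _).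
  by apply/funext => w; rewrite mul1r.
have d1 : depends n (fun _ : O => 1 : R) by [].
have := Rexp_path_density ac fd (measurable_cst _) d1 iM.
by rewrite Rexp_cst => ->; apply: eq_Rintegral => w _; rewrite mul1r.
Qed.

Lemma depends_path_density n : depends n (M n).
Proof. by move=> w w' ww'; apply: eq_bigr => i _; rewrite ww'. Qed.

Let gs n (w : O) : g (w n) = (fun v : O => g (v 0%N)) (shift n w).
Proof. by rewrite /shift addn0. Qed.

Let L2M1 n : L2 P (fun w => M n w - 1).
Proof. by apply: L2B; [exact: L2_path_density|exact: L2_cst]. Qed.

Let dM1 n : depends n (fun w => M n w - 1).
Proof. by move=> w w' /depends_path_density ->. Qed.

(** Orthogonality of martingale increments: [g (w n)] has mean 0 and is independent of [U] and
    [V]. *)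
Let Rexp_sqrD_indep n (U V : O -> R) (c : R) : L2 P U -> depends n U ->
  measurable_fun setT V -> (forall w, `|V w| <= c) -> depends n V ->
  \int[P]_w ((U w + V w * g (w n)) ^+ 2) =
  \int[P]_w (U w ^+ 2) + s * \int[P]_w (V w ^+ 2).
Proof.
move=> LU dU mV Vc dV; have LV := L2_bounded P mV Vc.
have Lgn : L2 P (fun w : O => g (w n)).
  by have := L2_shift n L2_density_sub1; congr (L2 _ _); apply/funext => w;
    exact/esym/gs.
rewrite Rexp_sqrD//; last exact: L2Ml Lgn mV Vc.
have -> : \int[P]_w (U w * (V w * g (w n))) = 0.
  rewrite -[RHS](mulr0 (\int[P]_w (U w * V w))) -Rexp_density_sub1.
  rewrite -(@Rexp_indep _ _ _ _ n); last 3 first.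
  - exact: L2M.
  - exact/L2_L1/L2_density_sub1.
  - by move=> w w' ww'; rewrite (dU _ _ ww') (dV _ _ ww').
  by apply: eq_Rintegral => w _; rewrite (gs n w) mulrA.
rewrite mulr0 addr0 mulrC; congr (_ + _).
rewrite -(@Rexp_indep _ _ _ _ n (fun w => V w ^+ 2)
  (fun w => (f (w 0%N) - 1) ^+ 2)); last 3 first.
- by case: LV.
- by case: L2_density_sub1.
- by move=> w w' ww'; rewrite (dV _ _ ww').
by apply: eq_Rintegral => w _; rewrite (gs n w) exprMn.
Qed.

Let s0 : 0 <= s. Proof. by apply: Rexp_ge0 => w; exact: sqr_ge0. Qed.

Let ME n w : M n.+1 w - 1 = (M n w - 1) + M n w * g (w n).
Proof. by rewrite /path_density big_ord_recr /=; ring. Qed.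

(** The second moments q_n of [M n - 1] satisfy q_(n+1) = q_n + s (1 + q_n). As long as
    [n * s <= 1/2] the inductive bound keeps q_n at most 1, so each step adds at most [2 s]. *)
Lemma variance_path_density n : n%:R * s <= 2^-1 ->
  \int[P]_w ((M n w - 1) ^+ 2) <= 2 * (n%:R * s).
Proof.
elim: n => [_|n IH].
  rewrite mul0r mulr0 -[leRHS](Rexp_cst P) le_eqVlt; apply/orP; left; apply/eqP.
  by apply: eq_Rintegral => w _; rewrite /path_density big_ord0 subrr expr0n.
rewrite -natr1 mulrDl mul1r => nS.
have ns : n%:R * s <= 2^-1 by have := s0; lra.
under eq_Rintegral do rewrite ME.
rewrite (@Rexp_sqrD_indep n (fun w => M n w - 1) (M n) ((1 + r) ^+ n))//;
  last 3 first.
- exact: measurable_path_density fd n.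
- exact: path_density_bound.
- exact: depends_path_density.
have -> : \int[P]_w (M n w ^+ 2) = \int[P]_w ((M n w - 1) ^+ 2) + 1.
  transitivity (\int[P]_w ((M n w - 1 + 1) ^+ 2)).
    by apply: eq_Rintegral => w _; rewrite subrK.
  rewrite Rexp_sqrD//; last exact: L2_cst.
  rewrite expr1n Rexp_cst [X in 2 * X](_ : _ = 0) ?mulr0 ?addr0//.
  under eq_Rintegral do rewrite mulr1.
  by rewrite RexpB ?Rexp_cst ?Rexp_path_density1 ?subrr//;
    [exact/L2_L1/L2_path_density|exact: L1_cst].
have {}IH := IH ns; have := s0.
move: (n%:R * s) IH ns => ns; move: s (Rintegral _ _ _) => S q qn n2 S0.
nra.
Qed.

Definition density_remainder n (w : O) : R := M n w - 1 - coord_sum (fun a => g a) n w.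

Lemma L2_density_remainder n : L2 P (density_remainder n).
Proof. by apply: L2B => //; exact: L2_coord_sum L2_density_sub1 n. Qed.

(** The increment of the remainder is [(M n - 1) * g (w n)], whose second moment is [s] times that
    of [M n - 1], hence at most [2 n s ^+ 2]; summation gives order [(n s) ^+ 2]. *)
Lemma norm2_density_remainder n : n%:R * s <= 2^-1 ->
  norm2 P (density_remainder n) <= 2 * (n%:R * s).
Proof.
move=> nS; rewrite -[leRHS]ger0_norm ?mulr_ge0// -sqrtr_sqr ler_wsqrtr//.
suff E : \int[P]_w (density_remainder n w ^+ 2) <= 2 * (n%:R * s) ^+ 2.
  by apply: (le_trans E); have := sqr_ge0 (n%:R * s); nra.
elim: n nS => [_|n IH].
  rewrite mul0r expr0n mulr0 -[leRHS](Rexp_cst P) le_eqVlt; apply/orP; left.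
  apply/eqP; apply: eq_Rintegral => w _; rewrite /density_remainder.
  by rewrite /path_density /coord_sum !big_ord0 !subrr expr0n.
rewrite -natr1 mulrDl mul1r => nS; have ns : n%:R * s <= 2^-1.
  by have := s0; lra.
have RE w : density_remainder n.+1 w =
    density_remainder n w + (M n w - 1) * g (w n).
  by rewrite /density_remainder ME /coord_sum big_ord_recr /=; ring.
under eq_Rintegral do rewrite RE.
rewrite (@Rexp_sqrD_indep n _ _ ((1 + r) ^+ n + 1))//; last 4 first.
- exact: L2_density_remainder.
- move=> w w' ww'; rewrite /density_remainder (depends_path_density ww').
  by rewrite (@depends_coord_sum _ _ _ _ _ _ _ ww').
- exact: L2_measurable (L2M1 n).
- move=> w; rewrite (le_trans (ler_normB _ _))// normr1 lerD2r.
  exact: path_density_bound.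
have := IH ns; have := variance_path_density ns; have := s0.
have : 0 <= n%:R * s by rewrite mulr_ge0.
move: (n%:R * s) => ns'; move: s => S ns0 S0 q1 q2.
have := ler_wpM2l S0 q1; have := sqr_ge0 S; have := mulr_ge0 ns0 S0; lra.
Qed.

Variables (Q : nat -> O -> R) (A : R).
Hypotheses (Q_cocycle : defective_adapted_cocycle Q) (L2Q : forall n, L2 P (Q n)).
Hypothesis A_var :
  forall n, (0 < n)%N -> norm2 P (centered Q mu n) <= A * Num.sqrt n%:R.

Lemma L1_cocycle_density n : L1 (path_measure mu') (Q n).
Proof.
have [mQ dQ] := cocycle_adapted Q_cocycle n.
apply: (L1_path_density ac fd mQ dQ); exact: L2M (L2_path_density n).
Qed.

Variables (nu : G -> R) (K t : R).
Hypotheses (mnu : measurable_fun setT nu) (nuK : forall a, `|nu a| <= K).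
Hypotheses (nu0 : \int[P]_w nu (w 0%N) = 0) (t0 : 0 < t).

Lemma first_order_expansion n : (0 < n)%N -> n%:R * s <= 2^-1 ->
  `|\int[path_measure mu']_w Q n w - \int[P]_w Q n w
    - t * \int[P]_w (Q n w * coord_sum nu n w)| <=
  n%:R * (2 * A * Num.sqrt n%:R * s +
    A * t * norm2 P (fun w => t^-1 * g (w 0%N) - nu (w 0%N))).
Proof.
(* [eta] is the error in replacing the difference quotient by [nu]; like both of them it has mean 0,
   so its sums grow only like [sqrt n]. *)
move=> n0 ns; pose eta a := t^-1 * g a - nu a.
have L2nu := L2_nu mu mnu nuK.
have L2eta : L2 P (fun w : O => eta (w 0%N)).
  by apply: L2B => //; apply: L2Zl; exact: L2_density_sub1.
have eta0 : \int[P]_w eta (w 0%N) = 0.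
  rewrite RexpB ?nu0 ?RexpZl ?Rexp_density_sub1 ?mulr0 ?subr0//.
  - exact/L2_L1/L2_density_sub1.
  - exact/L1Zl/L2_L1/L2_density_sub1.
  - exact/L2_L1.
have [mQ dQ] := cocycle_adapted Q_cocycle n.
have iQM := L2M (L2Q n) (L2_path_density n).
have LC : L2 P (centered Q mu n) by exact: L2B (L2Q n) (L2_cst _ _).
have LR := L2_density_remainder n.
have Lnu := L2_coord_sum L2nu n; have Leta := L2_coord_sum L2eta n.
have iQ := L2_L1 (L2Q n).
rewrite (Rexp_path_density ac fd mQ dQ iQM) -(RexpB iQM iQ).
(* Centring is free since [M n - 1] has mean 0, and it brings in the bound [A * sqrt n]. *)
have -> : \int[P]_w (Q n w * M n w - Q n w) =
    \int[P]_w (centered Q mu n w * (M n w - 1)).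
  set a := \int[P]_v Q n v.
  transitivity (\int[P]_w (centered Q mu n w * (M n w - 1) + a * (M n w - 1))).
    by apply: eq_Rintegral => w _; rewrite /centered -/a; ring.
  rewrite RexpD ?RexpZl ?RexpB ?Rexp_path_density1 ?Rexp_cst.
  by rewrite subrr mulr0 addr0.
  all: try exact: L1_cst.
  all: try exact/L2_L1/L2_path_density.
  all: try exact: L2_L1.
  - exact: L2M.
  - exact/L1Zl/L2_L1.
have iCn := L2M LC Lnu; have iCe := L2M LC Leta; have iCR := L2M LC LR.
have -> : \int[P]_w (Q n w * coord_sum nu n w) =
    \int[P]_w (centered Q mu n w * coord_sum nu n w).
  set a := \int[P]_v Q n v.
  transitivity (\int[P]_w (centered Q mu n w * coord_sum nu n w +
      a * coord_sum nu n w)).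
    by apply: eq_Rintegral => w _; rewrite /centered -/a; ring.
  have iS := L2_L1 Lnu.
  by rewrite (RexpD iCn (L1Zl _ iS)) (RexpZl _ iS) (Rexp_coord_sum L2nu nu0)
    mulr0 addr0.
(* From [f - 1 = t * (eta + nu)]: the [nu] part is the main term and cancels, the other two parts
   are the errors. *)
have -> : \int[P]_w (centered Q mu n w * (M n w - 1)) =
  \int[P]_w (centered Q mu n w * density_remainder n w) +
  t * \int[P]_w (centered Q mu n w * coord_sum eta n w) +
  t * \int[P]_w (centered Q mu n w * coord_sum nu n w).
  have i1 := L1Zl t iCn; have i2 := L1Zl t iCe.
  rewrite -(RexpZl t iCn) -(RexpZl t iCe) -(RexpD iCR i2) -(RexpD (L1D iCR i2) i1).
  apply: eq_Rintegral => w _; rewrite /density_remainder.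
  have -> : coord_sum (fun a => g a) n w = t * (coord_sum eta n w + coord_sum nu n w).
    rewrite /coord_sum -big_split mulr_sumr; apply: eq_bigr => i _.
    by rewrite /eta /= subrK mulVKf// gt_eqF.
  ring.
rewrite addrK mulrDr; apply: (le_trans (ler_normD _ _)).
have n1 : Num.sqrt n%:R * Num.sqrt n%:R = n%:R :> R by rewrite -expr2 sqr_sqrtr.
apply: lerD.
- apply: (le_trans (Rexp_cauchy_schwarz LC LR)).
  apply: (le_trans (ler_pM (norm2_ge0 _ _) (norm2_ge0 _ _) (A_var n0)
    (norm2_density_remainder ns))).
  by rewrite le_eqVlt; apply/orP; left; apply/eqP; ring.
- rewrite normrM gtr0_norm//.
  have := le_trans (Rexp_cauchy_schwarz LC Leta)
    (ler_wpM2r (norm2_ge0 _ _) (A_var n0)).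
  rewrite (norm2_coord_sum L2eta eta0) => /(ler_wpM2l (ltW t0))/le_trans; apply.
  by rewrite le_eqVlt; apply/orP; left; apply/eqP; rewrite -[in RHS]n1; ring.
Qed.

End density_expansion.

Lemma mem_unit_itv (R : realType) (t : R) : 0 <= t <= 1 -> t \in `[0%R, 1%R].
Proof. by rewrite in_itv. Qed.

(** * Elementary bounds and one-sided limits along sequences *)

Section real_bounds.
Variable R : realType.

Lemma ereal_sup_bound (S : set (\bar R)) : (ereal_sup S < +oo)%E ->
  exists2 C : R, 0 <= C & forall x, S x -> (x <= C%:E)%E.
Proof.
(* The maximum with 0 gives a nonnegative bound in all cases, including a supremum equal to
   [-oo]. *)
move=> S_oo; exists (Num.max 0 (fine (ereal_sup S))); first by rewrite le_max lexx.
move=> x /ereal_sup_ubound xS; apply: (le_trans xS).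
case: (ereal_sup S) S_oo => [r _|//|_]; last by rewrite leNye.
by rewrite lee_fin le_max lexx orbT.
Qed.

(** The tangent inequality at [- x], multiplied by [expR x]. *)
Lemma expR_sub1_le (x : R) : expR x - 1 <= x * expR x.
Proof.
have := expR_ge1Dx (- x); rewrite expRN.
have e0 := expR_gt0 x => /(ler_wpM2r (ltW e0)).
by rewrite mulVf ?gt_eqF// mulrBl mul1r; lra.
Qed.

Lemma norm_expR_sub1 (x : R) : `|expR x - 1| <= `|x| * expR `|x|.
Proof.
have [x0|x0] := leP 0 x.
  rewrite (ger0_norm x0) ger0_norm ?subr_ge0 -?expR0 ?ler_expR//.
  by rewrite expR0; exact: expR_sub1_le.
have ex : expR x - 1 <= 0 by rewrite subr_le0 -expR0 ler_expR ltW.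
rewrite ler0_norm// (@le_trans _ _ `|x|)//.
  by rewrite ltr0_norm//; have := expR_ge1Dx x; lra.
by rewrite ler_peMr// -expR0 ler_expR.
Qed.

Lemma norm_expR_sub1_sub (x : R) : `|expR x - 1 - x| <= `|x| ^+ 2 * expR `|x|.
Proof.
rewrite ger0_norm; last by have := expR_ge1Dx x; lra.
apply: (@le_trans _ _ (x * (expR x - 1))).
  by have := expR_sub1_le x; lra.
rewrite (le_trans (ler_norm _))// normrM expr2 -mulrA.
by rewrite ler_wpM2l// norm_expR_sub1.
Qed.

(** Sequences are needed for dominated convergence, and the bounds on the curve hold for
    [0 < t <= 1]; a sequence tending to 0 meets this after a shift of its index. *)
Lemma cvg_at_right0_seq (F : R -> R) (l : R) :
  (forall u : nat -> R, (forall k, 0 < u k <= 1) -> u @ \oo --> 0 ->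
    F (u k) @[k --> \oo] --> l) ->
  F t @[t --> 0^'+] --> l.
Proof.
move=> Fu; apply/cvg_at_rightP => u [u0 ucvg].
have [N _ uN] : \forall k \near \oo, u k <= 1.
  move/cvgrPdist_le : ucvg => /(_ 1 ltr01); apply: filterS => k.
  by rewrite sub0r normrN; exact/le_trans/ler_norm.
rewrite -(cvg_shiftn N); apply: Fu => [k|].
  by rewrite u0 uN//= leq_addl.
by rewrite (cvg_shiftn N).
Qed.

End real_bounds.

(** * The curve of densities near [t = 0] and its score *)

Section density_curve.
Context d (G : measurableType d) (R : realType).
Local Notation O := (Omega G).
Variables (mu : probability G R) (mu_ : R -> probability G R).
Variables (f : R -> G -> R) (nu : G -> R) (M B : R).
Local Notation P := (path_measure mu).
Hypothesis mu_ac : forall t : R, t \in `[0%R, 1%R] -> mu_ t `<< mu.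
Hypothesis f_density : forall t : R, t \in `[0%R, 1%R] -> is_density (mu_ t) mu (f t).
Hypothesis f_gt0 : forall (t : R) a, t \in `[0%R, 1%R] -> 0 < f t a.
Hypothesis nu_deriv : forall a,
  t^-1 * (ln (f t a) - ln (f 0 a)) @[t --> 0^'+] --> nu a.
Hypothesis nuM : forall a, `|nu a| <= M.
Hypothesis fB : forall (t : R) a, 0 < t <= 1 -> `|t^-1 * ln (f t a) - nu a| <= B.

Let tI (t : R) : 0 < t <= 1 -> t \in `[0%R, 1%R].
Proof. by move=> /andP[t0 t1]; rewrite in_itv /= ltW. Qed.

Let C := M + B.

Let C0 : 0 <= C.
Proof.
rewrite addr_ge0//; first exact: le_trans (nuM point).
by rewrite (le_trans _ (@fB 1 point _))// ltr01 lexx.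
Qed.

Lemma norm_ln_density (t : R) a : 0 < t <= 1 -> `|ln (f t a)| <= t * C.
Proof.
move=> t01; have /andP[t0 t1] := t01; rewrite -ler_pdivrMl//.
rewrite -[X in X * _]gtr0_norm ?invr_gt0// -normrM.
rewrite -[X in `|X|](subrK (nu a)) (le_trans (ler_normD _ _))// /C addrC lerD//.
exact: fB.
Qed.

Lemma norm_density_sub1 (t : R) a : 0 < t <= 1 -> `|f t a - 1| <= t * (C * expR C).
Proof.
move=> t01; have /andP[t0 t1] := t01; have fl := norm_ln_density a t01.
rewrite -[f t a]lnK ?posrE ?f_gt0 ?tI// (le_trans (norm_expR_sub1 _))// mulrA.
rewrite ler_pM// ?expR_ge0// ler_expR (le_trans fl)//.
by rewrite ler_piMl.
Qed.

(** The passage from [ln f] to [f - 1] costs an error of order [(t C) ^+ 2], negligible after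
    division by [t]. *)
Lemma density_quotient_cvg a : (t^-1 * (f t a - 1)) @[t --> 0^'+] --> nu a.
Proof.
have ln_cvg0 : ln (f t a) @[t --> 0^'+] --> 0.
  apply: (@cvg_at_right0_seq _ (fun t => ln (f t a))) => u u01 ucvg.
  apply: (@squeeze_cvgr _ _ _ _ (fun k => - (u k * C)) (fun k => u k * C)).
  - by apply: nearW => k; rewrite -ler_norml norm_ln_density.
  - by rewrite -oppr0 -(mul0r C); apply: cvgN; apply: cvgM => //; exact: cvg_cst.
  - by rewrite -(mul0r C); apply: cvgM => //; exact: cvg_cst.
(* [f 0] is just some version of the density at [t = 0], so its value at [a] is not prescribed. It
   is forced: the right derivative makes [ln (f t a)] tend to [ln (f 0 a)], while the uniform bound
   makes it tend to 0. *)
have ln0 : ln (f 0 a) = 0.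
  apply/esym; apply: (cvg_unique _ ln_cvg0) => //=.
  apply: (@cvg_at_right0_seq _ (fun t => ln (f t a))) => u u01 ucvg.
  have h : u k * ((u k)^-1 * (ln (f (u k) a) - ln (f 0 a))) + ln (f 0 a)
      @[k --> \oo] --> 0 * nu a + ln (f 0 a).
    apply: cvgD; last exact: cvg_cst.
    apply: cvgM => //; move/cvg_at_rightP : (@nu_deriv a); apply.
    by split => // k; case/andP: (u01 k).
  rewrite mul0r add0r in h; apply: cvg_trans h; apply: near_eq_cvg.
  apply: nearW => k; have /andP[uk0 _] := u01 k.
  by rewrite mulVKf ?gt_eqF// subrK.
apply: (@cvg_at_right0_seq _ (fun t => t^-1 * (f t a - 1))) => u u01 ucvg.
have lcvg : (u k)^-1 * ln (f (u k) a) @[k --> \oo] --> nu a.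
  move/cvg_at_rightP : (@nu_deriv a) => /(_ u) h.
  have {}h := h (conj (fun k => (proj1 (andP (u01 k)))) ucvg).
  apply: cvg_trans h; apply: near_eq_cvg; apply: nearW => k.
  by rewrite ln0 subr0.
have rcvg : (u k)^-1 * (f (u k) a - 1) - (u k)^-1 * ln (f (u k) a)
    @[k --> \oo] --> 0.
  pose b k := u k * (C ^+ 2 * expR C).
  have bcvg : b k @[k --> \oo] --> 0.
    by rewrite -(mul0r (C ^+ 2 * expR C)); apply: cvgM => //; exact: cvg_cst.
  apply: (@squeeze_cvgr _ _ _ _ (fun k => - b k) b) => //; last first.
    by rewrite -oppr0; exact: cvgN.
  apply: nearW => k; rewrite -ler_norml; have /andP[uk0 uk1] := u01 k.
  rewrite -mulrBr normrM gtr0_norm ?invr_gt0// ler_pdivrMl// /b.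
  rewrite -{1}[f _ a]lnK ?posrE ?f_gt0 ?tI//.
  have fl := norm_ln_density a (u01 k).
  apply: (le_trans (norm_expR_sub1_sub _)).
  rewrite [leRHS](_ : _ = (u k * C) ^+ 2 * expR C); last by ring.
  rewrite ler_pM ?sqr_ge0 ?expR_ge0//.
    by rewrite lerXn2r ?nnegrE ?mulr_ge0// ltW.
  by rewrite ler_expR (le_trans fl)// ler_piMl.
have h : (u k)^-1 * (f (u k) a - 1) - (u k)^-1 * ln (f (u k) a) +
    (u k)^-1 * ln (f (u k) a) @[k --> \oo] --> 0 + nu a by exact: cvgD.
rewrite add0r in h; apply: cvg_trans h.
by apply: near_eq_cvg; apply: nearW => k /=; rewrite subrK.
Qed.

(** [nu] is a pointwise limit of measurable difference quotients along [t = 1 / (k + 1)]. *)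
Lemma measurable_score : measurable_fun setT nu.
Proof.
pose u k : R := k.+1%:R^-1.
have u01 k : 0 < u k <= 1.
  by rewrite /u invr_gt0 ltr0n /= invf_le1 ?ltr0n// ler1n.
have ucvg : u @ \oo --> 0 by exact: cvg_harmonic.
apply: (@measurable_fun_cvg _ _ _ _ (fun k a => (u k)^-1 * (f (u k) a - 1))).
  move=> k; apply: measurable_funM => //; apply: measurable_funB => //.
  by case: (f_density (tI (u01 k))).
move=> a _; move/cvg_at_rightP : (@density_quotient_cvg a); apply.
by split => // k; case/andP: (u01 k).
Qed.

(** Bounded convergence: the quotients converge pointwise and stay below a constant independent of
    [t]. *)
Lemma norm2_density_quotient_cvg :
  norm2 P (fun w => t^-1 * (f t (w 0%N) - 1) - nu (w 0%N)) @[t --> 0^'+] --> 0.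
Proof.
apply: (@cvg_at_right0_seq _ (fun t =>
  norm2 P (fun w => t^-1 * (f t (w 0%N) - 1) - nu (w 0%N)))) => u u01 ucvg.
pose h k (w : O) := ((u k)^-1 * (f (u k) (w 0%N) - 1) - nu (w 0%N)) ^+ 2.
have mc := @measurable_coord _ G 0.
have mh k : measurable_fun setT (h k).
  apply: measurable_funX; apply: measurable_funB; last first.
    exact: (measurableT_comp measurable_score mc).
  apply: measurable_funM => //; apply: measurable_funB => //.
  by apply: measurableT_comp mc; case: (f_density (tI (u01 k))).
pose D := C * expR C + M.
have hD k w : `|h k w| <= D ^+ 2.
  have /andP[uk0 uk1] := u01 k; rewrite normrX lerXn2r ?nnegrE//.
    by rewrite addr_ge0// ?mulr_ge0 ?expR_ge0// (le_trans _ (nuM point)).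
  rewrite (le_trans (ler_normB _ _))// lerD//.
  rewrite normrM gtr0_norm ?invr_gt0// ler_pdivrMl//.
  exact: norm_density_sub1.
have hcvg w : h k w @[k --> \oo] --> 0.
  have -> : 0 = (nu (w 0%N) - nu (w 0%N)) * (nu (w 0%N) - nu (w 0%N)) :> R.
    by rewrite subrr mul0r.
  have hc : (u k)^-1 * (f (u k) (w 0%N) - 1) - nu (w 0%N) @[k --> \oo] -->
      nu (w 0%N) - nu (w 0%N).
    apply: cvgB; last exact: cvg_cst.
    move/cvg_at_rightP : (@density_quotient_cvg (w 0%N)); apply.
    by split => // k; case/andP: (u01 k).
  by apply: cvg_trans (cvgM hc hc); apply: near_eq_cvg; exact: nearW.
have [_ _] : [/\ P.-integrable setT (fun=> 0%:E),
    (\int[P]_w `|(h k w)%:E - 0%:E| @[k --> \oo] --> 0)%E &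
    (\int[P]_w (h k w)%:E @[k --> \oo] --> \int[P]_w 0%:E)%E].
  apply: (@dominated_convergence _ _ _ P setT measurableT
    (fun k w => (h k w)%:E) (fun=> 0%:E) (fun=> (D ^+ 2)%:E)) => //.
  - by move=> k; exact/measurable_EFinP.
  - by apply: aeW => w _; apply: cvg_EFin; [exact: nearW|exact: hcvg].
  - exact: L1_cst.
  - by apply: aeW => w k _; rewrite /= lee_fin hD.
rewrite probability_integral_cst => /fine_cvg hh.
by have := cvg_comp _ _ hh (@sqrt_continuous R 0); rewrite /= sqrtr0.
Qed.

(** The quotient of [f t - 1] by [t] has mean 0, so the mean of [nu] is at most its L^2-distance to
    the quotient, which tends to 0. *)
Lemma Rexp_score : \int[P]_w nu (w 0%N) = 0.
Proof.
have L2n := L2_nu mu measurable_score nuM.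
have bound (t : R) : 0 < t <= 1 -> `|\int[P]_w nu (w 0%N)| <=
    norm2 P (fun w => t^-1 * (f t (w 0%N) - 1) - nu (w 0%N)).
  move=> t01; have fd := f_density (tI t01); have ac := mu_ac (tI t01).
  have fb a := norm_density_sub1 a t01.
  have L2f := L2_density_sub1 fd fb.
  have L2t := L2Zl t^-1 L2f.
  apply: le_trans (ler_norm_Rexp_norm2 (L2B L2t L2n)).
  rewrite (RexpB (L2_L1 L2t) (L2_L1 L2n)) (RexpZl _ (L2_L1 L2f)).
  by rewrite (Rexp_density_sub1 ac fd fb) mulr0 sub0r normrN.
apply/eqP; rewrite -normr_le0.
have h := norm2_density_quotient_cvg.
rewrite -(cvg_lim _ h)//; apply: limr_ge; first by apply/cvg_ex; exists 0.
near=> t; apply: bound; apply/andP; split; near: t.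
  exact: nbhs_right_gt.
exact: nbhs_right_le.
Unshelve. all: by end_near. Qed.

End density_curve.

(* For a given t choose n of order L / t: then a / (n t) <= a / L, while
   sqrt n * t is of order sqrt (L t). Let t tend to 0, then L to infinity. *)
Lemma cvg_of_scale (R : realType) (D e : R -> R) (s : nat -> R) (l a b c k : R) :
  0 <= a -> 0 <= b -> 0 <= c -> 0 <= k ->
  s @ \oo --> l -> e t @[t --> 0^'+] --> 0 ->
  (forall (t : R) n, 0 < t <= 1 -> (0 < n)%N -> n%:R * t ^+ 2 * k <= 2^-1 ->
    `|D t - s n| <= a / (n%:R * t) + b * (Num.sqrt n%:R * t) + c * e t) ->
  D t @[t --> 0^'+] --> l.
Proof.
move=> a0 b0 c0 k0 scvg ecvg DS; apply/cvgrPdist_le => eps eps0.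
have eps4 : 0 < eps / 4 by rewrite divr_gt0.
pose L := (Num.truncn (a / (eps / 4))).+1.
have L0 : 0 < L%:R :> R by rewrite ltr0n.
have aL : a / L%:R <= eps / 4.
  by rewrite ler_pdivrMr// mulrC -ler_pdivrMr// ltW// truncnS_gt.
have [N _ sN] : \forall n \near \oo, `|l - s n| <= eps / 4.
  by move/cvgrPdist_le : scvg => /(_ _ eps4).
have ec0 : 0 < eps / 4 / (c + 1) by rewrite divr_gt0// ltr_wpDl.
have eN : \forall t \near 0^'+, `|0 - e t| <= eps / 4 / (c + 1).
  by move/cvgrPdist_le : ecvg => /(_ _ ec0).
(* With [n * t ^+ 2 <= 2 * L * t], [t <= d1] ensures the smallness condition [n * t ^+ 2 * k <= 1/2]
   and [t <= d2] puts the square-root term below [eps / 4]. The summands 1 keep the denominators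
   positive. *)
pose d1 : R := (4 * L%:R * k + 1)^-1.
pose d2 : R := (eps / 4) ^+ 2 / (2 * L%:R * b ^+ 2 + 1).
have p1 : 0 < 4 * L%:R * k + 1 by rewrite ltr_wpDl// !mulr_ge0.
have p2 : 0 < 2 * L%:R * b ^+ 2 + 1 by rewrite ltr_wpDl// !mulr_ge0.
have d10 : 0 < d1 by rewrite invr_gt0.
have d20 : 0 < d2 by rewrite divr_gt0// exprn_gt0.
have N0 : 0 < N.+1%:R^-1 :> R by rewrite invr_gt0 ltr0n.
near=> t.
have t0 : 0 < t by near: t; exact: nbhs_right_gt.
have t1 : t <= 1 by near: t; exact: nbhs_right_le.
have td1 : t <= d1 by near: t; exact: nbhs_right_le.
have td2 : t <= d2 by near: t; exact: nbhs_right_le.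
have tN : t <= N.+1%:R^-1 by near: t; exact: nbhs_right_le.
have te : `|0 - e t| <= eps / 4 / (c + 1) by near: t.
(* [m] is 1 / t rounded up, so [m * t] lies between 1 and 2 and [n * t] between [L] and [2 L]. *)
pose m := (Num.truncn t^-1).+1; pose n := (L * m)%N.
have mt1 : 1 <= m%:R * t by rewrite -ler_pdivrMr// mul1r ltW// truncnS_gt.
have mt2 : m%:R * t <= 2.
  have -> : m%:R = (Num.truncn t^-1)%:R + 1 :> R by rewrite natr1.
  rewrite mulrDl mul1r (_ : 2 = 1 + 1 :> R)// lerD//.
  by rewrite -ler_pdivlMr// mul1r truncn_le// invr_ge0 ltW.
have nt : L%:R <= n%:R * t by rewrite natrM -mulrA ler_peMr// ltW.
have nt2 : n%:R * t ^+ 2 <= 2 * L%:R * t.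
  have -> : n%:R * t ^+ 2 = L%:R * (m%:R * t) * t by rewrite natrM; ring.
  by apply: (ler_wpM2r (ltW t0)); rewrite mulrC; exact: (ler_wpM2r (ltW L0)).
have nN : (N <= n)%N.
  rewrite (@leq_trans m) ?leq_pmull// -(ler_nat R) (@le_trans _ _ N.+1%:R)//.
    by rewrite ler_nat.
  rewrite (@le_trans _ _ t^-1)//; last by rewrite ltW// truncnS_gt.
  by rewrite -[leLHS]invrK lef_pV2 ?posrE.
have n0 : (0 < n)%N by [].
have h1 : `|s n - l| <= eps / 4 by rewrite distrC; exact: sN.
have h2 : `|s n - D t| <= eps / 4 + eps / 4 + eps / 4.
  rewrite distrC; apply: le_trans (DS t n _ n0 _) _; first by rewrite t0.
    rewrite (le_trans (ler_wpM2r k0 nt2))//.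
    move: td1; rewrite /d1 -[leRHS]mul1r ler_pdivlMr//; nra.
  rewrite !lerD//.
  - by rewrite (le_trans _ aL)// ler_wpM2l// lef_pV2 ?posrE// (lt_le_trans L0).
  - rewrite -(ler_pXn2r (n := 2)) ?nnegrE ?(ltW eps4) ?mulr_ge0 ?sqrtr_ge0 ?(ltW t0)//.
    rewrite !exprMn sqr_sqrtr//.
    rewrite (le_trans (ler_wpM2l (sqr_ge0 b) nt2))//.
    by move: td2; rewrite /d2 ler_pdivlMr// => td2; have := t0; lra.
  - rewrite (le_trans (ler_norm _))// normrM (ger0_norm c0).
    move: te; rewrite sub0r normrN ler_pdivlMr ?ltr_wpDl// => te.
    have := normr_ge0 (e t); have : 0 <= c * `|e t| by rewrite mulr_ge0.
    by lra.
have := ler_distD (s n) l (D t); rewrite (distrC l (s n)); lra.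
Unshelve. all: by end_near. Qed.

(** * From moment hypotheses to L^2 bounds, and the derivative of the rate of escape *)

Lemma L2_of_expectation d (T : measurableType d) (R : realType)
    (P : probability T R) (F : T -> R) (C : R) : measurable_fun setT F -> 0 <= C ->
  ('E_P[fun w => (`|F w| ^+ 2)%R] <= C%:E)%E ->
  L2 P F /\ norm2 P F <= Num.sqrt C.
Proof.
move=> mF C0; rewrite unlock => FC.
have FC' : (\int[P]_w (F w ^+ 2)%:E <= C%:E)%E.
  apply: le_trans FC; rewrite le_eqVlt; apply/orP; left; apply/eqP.
  by apply: eq_integral => w _; rewrite real_normK ?num_real.
have LF : L2 P F.
  split => //; apply/integrableP; split.
    by apply/measurable_EFinP; exact: measurable_funX.
  apply: le_lt_trans (ltry C); apply: le_trans FC'.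
  rewrite le_eqVlt; apply/orP; left; apply/eqP.
  by apply: eq_integral => w _; rewrite /= ger0_norm ?sqr_ge0.
split => //; rewrite ler_wsqrtr// -lee_fin -integral_RexpE//; exact: LF.2.
Qed.

Unset Implicit Arguments.

Theorem theorem5p3 (d : measure_display) (G : measurableType d) (R : realType)
  (mu : probability G R) (Q : nat -> Omega G -> R)
  (Q_cocycle : defective_adapted_cocycle Q)
  (Q_moment : finite_second_moment mu Q)
  (Q_deviation : second_moment_deviation mu Q)
  (mu_ : R -> probability G R)
  (mu_0 : mu_ 0 = mu)
  (mu_ac : forall t, t \in `[0%R, 1%R] -> mu_ t `<< mu)
  (f : R -> G -> R)
  (f_density : forall t, t \in `[0%R, 1%R] -> is_density (mu_ t) mu (f t))
  (f_gt0 : forall t a, t \in `[0%R, 1%R] -> 0 < f t a)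
  (nu : G -> R)
  (nu_deriv : forall a,
    t^-1 * (ln (f t a) - ln (f 0 a)) @[t --> 0^'+] --> nu a)
  (nu_bounded : exists M : R, forall a, `|nu a| <= M)
  (f_unif : (ereal_sup [set `|t^-1 * ln (f t a) - nu a|%:E |
                        t in `]0%R, 1%R] & a in [set: G]] < +oo)%E)
  (Q_unif_deviation : uniform_first_moment_deviation mu_ Q) :
  cvg (score_covariation nu mu Q n @[n --> \oo]) /\
  t^-1 * (rate_of_escape (mu_ t) Q - rate_of_escape mu Q) @[t --> 0^'+]
    --> sigma nu mu Q.
Proof.
have [M nuM] := nu_bounded.
have [B _ fB] := ereal_sup_bound f_unif.
have {}fB (t : R) a : 0 < t <= 1 -> `|t^-1 * ln (f t a) - nu a| <= B.
  by move=> t01; rewrite -lee_fin; apply: fB; exists t; [rewrite /= in_itv|exists a].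
have [C C0 QC] := ereal_sup_bound Q_unif_deviation.
have {}QC (t : R) n m : t \in `[0%R, 1%R] ->
    \int[path_measure (mu_ t)]_w `|defect Q n m w| <= C.
  move=> t01; have := QC _ (ex_intro2 _ _ t t01 erefl).
  move=> /(le_trans (ereal_sup_ubound
    (ex_intro2 _ _ n I (ex_intro2 _ _ m I erefl)))).
  rewrite unlock /Rintegral.
  have : (0 <= \int[path_measure (mu_ t)]_w (`|defect Q n m w|)%:E)%E.
    by apply: integral_ge0 => w _; rewrite lee_fin.
  by case: (integral _ _ _).
have [mQ1 _] := cocycle_adapted Q_cocycle 1.
have L2Q1 : L2 (path_measure mu) (Q 1%N).
  have := Q_moment; rewrite /finite_second_moment.
  set E := expectation _ _ => E_oo.
  have : (0 <= E)%E by apply: expectation_ge0 => w; exact: sqr_ge0.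
  case EE : E E_oo => [c| |]// _; rewrite lee_fin => c0.
  by apply: (@L2_of_expectation _ _ _ _ _ c _ c0 _).1 => //; rewrite -/E EE.
have [tau2 tau20 Q2] := ereal_sup_bound Q_deviation.
have defectP n m : L2 (path_measure mu) (defect Q n m) /\
    norm2 (path_measure mu) (defect Q n m) <= Num.sqrt tau2.
  apply: L2_of_expectation => //; first exact: measurable_defect.
  by apply: Q2; exists n => //; exists m.
have L2D n m := (defectP n m).1; have tauD n m := (defectP n m).2.
have mnu := measurable_score f_density f_gt0 nu_deriv nuM fB.
have nu0 := Rexp_score mu_ac f_density f_gt0 nu_deriv nuM fB.
have scvg := score_covariation_cvg Q_cocycle L2Q1 L2D tauD mnu nuM nu0.
split => //.
have [A A0 A_var] := norm2_centered Q_cocycle L2Q1 L2D tauD.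
have L2Q := L2_cocycle Q_cocycle L2Q1 L2D.
pose K := (M + B) * expR (M + B).
have K0 : 0 <= K.
  rewrite mulr_ge0 ?expR_ge0// addr_ge0//; first exact: le_trans (nuM point).
  by rewrite (le_trans _ (fB 1 point _))// ltr01 lexx.
have fK (t : R) a : 0 < t <= 1 -> `|f t a - 1| <= t * K.
  exact: (norm_density_sub1 f_gt0 nuM fB a).
have ecvg := norm2_density_quotient_cvg f_density f_gt0 nu_deriv nuM fB.
(* [2 * C]: the two rates of escape, each known up to [C / n]. [2 * A * K ^+ 2]: the density
   remainder, using [s <= t ^+ 2 * K ^+ 2]. [A]: the replacement of the quotient by [nu]. The last
   [K ^+ 2] turns the smallness condition into [n * s <= 1/2]. *)
apply: (@cvg_of_scale _ _ _ (score_covariation nu mu Q) _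
  (2 * C) (2 * A * K ^+ 2) A (K ^+ 2) _ _ A0 (sqr_ge0 K) scvg ecvg).
- exact: mulr_ge0.
- by apply: mulr_ge0 (sqr_ge0 K); exact: mulr_ge0.
move=> t n t01 n0 ntK; have /andP[t0 t1] := t01.
have t01' : 0 <= t <= 1 by rewrite ltW.
have tI := mem_unit_itv t01'.
have I0 : (0 : R) <= (0 : R) <= (1 : R) by rewrite lexx ler01.
have {}I0 := mem_unit_itv I0.
pose s := \int[path_measure mu]_w ((f t (w 0%N) - 1) ^+ 2).
have sK : s <= t ^+ 2 * K ^+ 2.
  rewrite -exprMn -[leRHS](Rexp_cst (path_measure mu)); apply: le_Rexp.
  - by case: (L2_density_sub1 (mu := mu) (f_density t tI) (fun a => fK t a t01)).
  - exact: L1_cst.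
  - move=> w; rewrite -real_normK ?num_real// lerXn2r ?nnegrE ?fK//.
    by rewrite mulr_ge0// ltW.
have ns : n%:R * s <= 2^-1.
  by apply: le_trans ntK; rewrite -mulrA ler_wpM2l.
have := first_order_expansion (mu_ac t tI) (f_density t tI)
  (fun a => fK t a t01) Q_cocycle L2Q A_var mnu nuM nu0 t0 n0 ns.
have rt := rate_of_escape_cvg (L1_cocycle_density (mu_ac t tI)
  (f_density t tI) (fun a => fK t a t01) Q_cocycle L2Q) (fun n m => QC t n m tI) n0.
(* [mu] is the member [t = 0] of the family, so the same [C] serves. *)
have r0 : `|n%:R^-1 * \int[path_measure mu]_w Q n w - rate_of_escape mu Q| <=
    C * n%:R^-1.
  apply: rate_of_escape_cvg => // [m|m1 m2]; first exact/L2_L1.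
  by rewrite -mu_0; exact: (QC 0 m1 m2 I0).
rewrite score_covariationE; move: rt r0 => /=.
set at_ := Rintegral _ _ _; set a0 := Rintegral _ _ _; set cn := Rintegral _ _ _.
set e := norm2 _ _; rewrite -/s; set lt_ := rate_of_escape _ _.
set l0 := rate_of_escape _ _ => rt r0 h.
have nR : 0 < n%:R :> R by rewrite ltr0n.
have {}h : `|n%:R^-1 * (at_ - a0 - t * cn)| <=
    2 * A * Num.sqrt n%:R * s + A * t * e.
  by rewrite normrM gtr0_norm ?invr_gt0// ler_pdivrMl.
have As : 2 * A * Num.sqrt n%:R * s <=
    2 * A * Num.sqrt n%:R * (t ^+ 2 * K ^+ 2).
  by rewrite ler_wpM2l// !mulr_ge0// sqrtr_ge0.
have key : `|lt_ - l0 - t * (n%:R^-1 * cn)| <=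
    2 * C * n%:R^-1 + 2 * A * Num.sqrt n%:R * (t ^+ 2 * K ^+ 2) + A * t * e.
  move: rt r0 h; rewrite !ler_norml !mulrBr (mulrCA n%:R^-1 t).
  move=> /andP[? ?] /andP[? ?] /andP[? ?]; apply/andP; split; lra.
have -> : t^-1 * (lt_ - l0) - n%:R^-1 * cn = t^-1 * (lt_ - l0 - t * (n%:R^-1 * cn)).
  by field; rewrite !gt_eqF.
rewrite normrM gtr0_norm ?invr_gt0// ler_pdivrMl// (le_trans key)//.
by rewrite le_eqVlt; apply/orP; left; apply/eqP; field; rewrite !gt_eqF.
Qed.
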